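(* Let $k$ be a field and let $d \geq 3$ be an integer. Let $k\Theta(d)$ be the path algebra of the generalised Kronecker quiver $\Theta(d)$. Then the family of all indecomposable postinjective finite dimensional $k\Theta(d)$-modules is hyperfinite.
   Context: The generalised Kronecker quiver $\Theta(d)$ has two vertices $1,2$ and exactly $d$ arrows, all going from $1$ to $2$. Modules over $k\Theta(d)$ are identified with representations of $\Theta(d)$ over $k$. An indecomposable finite dimensional module is postinjective (also called preinjective) if it is of the form $\tau^{r}I$ with $r \geq 0$ and $I$ indecomposable injective, where $\tau$ is the Auslander–Reiten translation. Hyperfiniteness: Let $A$ be a finite dimensional $k$-algebra and let $\mathcal{M}$ be a set of finite dimensional $A$-modules (a family of modules is understood up to isomorphism). $\mathcal{M}$ is hyperfinite if for every $\varepsilon > 0$ there exists a number $L_\varepsilon > 0$ such that for every $M \in \mathcal{M}$ there exist a submodule $N \subseteq M$ with $\dim_k N \geq (1-\varepsilon)\dim_k M$ and finite dimensional $A$-modules $N_1,\dots,N_t$ with $\dim_k N_i \leq L_\varepsilon$ for all $i$, such that $N \cong \bigoplus_{i=1}^t N_i$. *)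

(* Defs.v *)
From HB Require Import structures.
From mathcomp Require Import all_boot all_order all_algebra all_field reals.

Set Implicit Arguments.
Unset Strict Implicit.
Unset Printing Implicit Defensive.

Import Order.TTheory GRing.Theory Num.Theory.
Local Open Scope ring_scope.

(* Finite dimensional left and right modules. They are records on top of
   [vectType k] because [lmodType A] does not come with a compatible finite
   dimensional vector space structure over k. *)

Section Modules.
Variables (k : fieldType) (A : falgType k).

Record fdmodule := FDModule {
  lcarrier :> vectType k;
  lact : A -> 'End(lcarrier);
  lact_linear : linear lact;
  lact1 : lact 1 = \1%VF;
  lactM : forall a b, lact (a * b) = (lact a \o lact b)%VF }.

Record fdrmodule := FDRModule {
  rcarrier :> vectType k;
  ract : A -> 'End(rcarrier);
  ract_linear : linear ract;
  ract1 : ract 1 = \1%VF;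
  ractM : forall a b, ract (a * b) = (ract b \o ract a)%VF }.

Definition is_hom (M N : fdmodule) (f : 'Hom(M, N)) : Prop :=
  forall a m, f (lact M a m) = lact N a (f m).

Definition is_rhom (M N : fdrmodule) (f : 'Hom(M, N)) : Prop :=
  forall a m, f (ract M a m) = ract N a (f m).

Definition fdmod_iso (M N : fdmodule) : Prop :=
  exists2 f : 'Hom(M, N), is_hom f & bijective f.

Lemma act_linfun (V W : vectType k) (F : A -> V -> W) :
    (forall a, linear (F a)) -> (forall v, linear (F^~ v)) ->
  linear (fun a => linfun (F a)) /\ forall a v, linfun (F a) v = F a v.
Proof.
move=> Fr Fl.
have E a v : linfun (F a) v = F a v.
  pose L : {linear V -> W} :=
    HB.pack (F a) (GRing.isLinear.Build k V W *:%R (F a) (Fr a)).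
  exact: (lfunE L).
split=> // c a b; apply/lfunP=> v.
by rewrite add_lfunE scale_lfunE !E Fl.
Qed.

Lemma linfunE (V W : vectType k) (F : V -> W) :
  linear F -> forall v, linfun F v = F v.
Proof.
move=> Fl v.
pose L : {linear V -> W} :=
  HB.pack F (GRing.isLinear.Build k V W *:%R F Fl).
exact: (lfunE L).
Qed.

Lemma lact_lin (M : fdmodule) c a b m :
  lact M (c *: a + b) m = c *: lact M a m + lact M b m.
Proof. by rewrite lact_linear add_lfunE scale_lfunE. Qed.

Lemma ract_lin (M : fdrmodule) c a b m :
  ract M (c *: a + b) m = c *: ract M a m + ract M b m.
Proof. by rewrite ract_linear add_lfunE scale_lfunE. Qed.

Fact zero_act_linear : linear (fun _ : A => (0 : 'End('rV[k]_0))).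
Proof. by move=> c a b; rewrite scaler0 addr0. Qed.

Fact zero_act1 : (0 : 'End('rV[k]_0)) = \1%VF.
Proof. by apply/lfunP=> v; rewrite [LHS]thinmx0 [RHS]thinmx0. Qed.

Fact zero_actM (a b : A) (z := 0 : 'End('rV[k]_0)) : z = (z \o z)%VF.
Proof. by rewrite comp_lfun0l. Qed.

Definition zero_module : fdmodule :=
  FDModule zero_act_linear zero_act1 zero_actM.

Section DirectSum.
Variables M N : fdmodule.

Definition dsum_act (a : A) : 'End((M * N)%type) :=
  linfun (fun x : M * N => (lact M a x.1, lact N a x.2)).

Fact dsum_actP : linear dsum_act /\
  forall a x, dsum_act a x = (lact M a x.1, lact N a x.2).
Proof.
apply: (act_linfun (F := fun a (x : M * N) => (lact M a x.1, lact N a x.2))).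
  by move=> a c x y /=; rewrite !linearP.
by move=> x c a b /=; rewrite !lact_lin.
Qed.

Fact dsum_act1 : dsum_act 1 = \1%VF.
Proof. by apply/lfunP=> -[x y]; rewrite dsum_actP.2 !lact1 !id_lfunE. Qed.

Fact dsum_actM a b : dsum_act (a * b) = (dsum_act a \o dsum_act b)%VF.
Proof.
by apply/lfunP=> x; rewrite comp_lfunE !dsum_actP.2 !lactM !comp_lfunE.
Qed.

Definition dsum : fdmodule := FDModule dsum_actP.1 dsum_act1 dsum_actM.
End DirectSum.

Definition is_submodule (M : fdmodule) (U : {vspace M}) : Prop :=
  forall a, (lact M a @: U <= U)%VS.

Section Submodule.
Variables (M : fdmodule) (U : {vspace M}) (hU : is_submodule U).

Definition submod_act (a : A) : 'End(subvs_of U) :=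
  linfun (fun u : subvs_of U => vsproj U (lact M a (vsval u))).

Fact submod_actP : linear submod_act /\
  forall a u, submod_act a u = vsproj U (lact M a (vsval u)).
Proof.
apply: (act_linfun
  (F := fun a (u : subvs_of U) => vsproj U (lact M a (vsval u)))).
  by move=> a c x y; rewrite !linearP.
by move=> x c a b; rewrite lact_lin linearP.
Qed.

Lemma submod_actE a u : vsval (submod_act a u) = lact M a (vsval u).
Proof.
rewrite submod_actP.2 vsprojK //.
by apply: (subvP (hU a)); rewrite memv_img ?subvsP.
Qed.

Fact submod_act1 : submod_act 1 = \1%VF.
Proof. by apply/lfunP=> u; apply: val_inj; rewrite /= submod_actE lact1 !id_lfunE. Qed.

Fact submod_actM a b : submod_act (a * b) = (submod_act a \o submod_act b)%VF.
Proof.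
apply/lfunP=> u; apply: val_inj.
by rewrite comp_lfunE /= !submod_actE lactM comp_lfunE.
Qed.

Definition submod : fdmodule := FDModule submod_actP.1 submod_act1 submod_actM.
End Submodule.

Definition indecomposable (M : fdmodule) : Prop :=
  \dim {:M} != 0%N /\
  forall M1 M2 : fdmodule, fdmod_iso M (dsum M1 M2) ->
    \dim {:M1} = 0%N \/ \dim {:M2} = 0%N.

Definition projective_module (P : fdmodule) : Prop :=
  forall (M N : fdmodule) (g : 'Hom(M, N)) (f : 'Hom(P, N)),
    is_hom g -> limg g = fullv -> is_hom f ->
    exists2 h : 'Hom(P, M), is_hom h & (g \o h)%VF = f.

Definition injective_module (I : fdmodule) : Prop :=
  forall (M N : fdmodule) (g : 'Hom(M, N)) (f : 'Hom(M, I)),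
    is_hom g -> lker g = 0%VS -> is_hom f ->
    exists2 h : 'Hom(N, I), is_hom h & (h \o g)%VF = f.

Fact regular_act_linear : linear (@amull k A).
Proof. by move=> c a b; rewrite linearP. Qed.

Definition regular_module : fdmodule :=
  FDModule regular_act_linear (amull1 A) (@amullM k A).

(* It suffices to test compatibility with the action on a basis of A;
   see [mem_homspace]. *)
Definition homspace (M N : fdmodule) : {vspace 'Hom(M, N)} :=
  (\bigcap_(i < \dim {:A})
     lker (linfun (fun f : 'Hom(M, N) =>
       (f \o lact M (vbasis {:A})`_i) - (lact N (vbasis {:A})`_i \o f))%VF))%VS.

Lemma mem_homspace (M N : fdmodule) (f : 'Hom(M, N)) :
  f \in homspace M N <-> is_hom f.
Proof.
pose D i (f : 'Hom(M, N)) :=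
  ((f \o lact M (vbasis {:A})`_i) - (lact N (vbasis {:A})`_i \o f))%VF.
have Dl i : linear (D i).
  move=> c f1 f2; apply/lfunP=> v; rewrite /D !(lfunE, linearP) /=.
  rewrite !(add_lfunE, opp_lfunE, scale_lfunE, comp_lfunE) linearP scalerBr.
  by rewrite opprD addrACA.
have kerE (i : 'I_(\dim {:A})) : (f \in lker (linfun (D i))) = (D i f == 0).
  by rewrite memv_ker linfunE.
split=> [|hf].
  move/subv_bigcapP=> Hf a m; rewrite (coord_vbasis (memvf a)).
  have sumE (Q : fdmodule) q :
      lact Q (\sum_(i < \dim {:A}) coord (vbasis {:A}) i a *: (vbasis {:A})`_i) q
      = \sum_(i < \dim {:A})
          coord (vbasis {:A}) i a *: lact Q (vbasis {:A})`_i q.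
    elim/big_rec2: _ => [|i y1 y2 _ <-]; last by rewrite lact_lin.
    by have := lact_lin (-1) 0 0 q; rewrite scaler0 addr0 scaleN1r addNr.
  rewrite !sumE linear_sum; apply: eq_bigr => i _; rewrite linearZ /=.
  congr (_ *: _); apply/eqP; rewrite -subr_eq0.
  have := Hf i isT; rewrite -memvE kerE /D => /eqP/lfunP/(_ m).
  by rewrite !(add_lfunE, opp_lfunE, comp_lfunE, zero_lfunE) => ->.
apply/subv_bigcapP=> i _; rewrite -memvE kerE; apply/eqP/lfunP=> m.
by rewrite !(add_lfunE, opp_lfunE, comp_lfunE, zero_lfunE) hf subrr.
Qed.

(* The right module Hom_A(M, A), with (f . a)(m) = f(m) * a. *)
Section HomToRegular.
Variable M : fdmodule.
Local Notation H := (homspace M regular_module).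

Definition homA_act (a : A) : 'End(subvs_of H) :=
  linfun (fun f : subvs_of H => vsproj H (amulr a \o vsval f)%VF).

Fact homA_actP : linear homA_act /\
  forall a f, homA_act a f = vsproj H (amulr a \o vsval f)%VF.
Proof.
apply: (act_linfun
  (F := fun a (f : subvs_of H) => vsproj H (amulr a \o vsval f)%VF)).
  by move=> a c x y; rewrite linearP comp_lfunDr -comp_lfunZr linearP.
by move=> x c a b; rewrite linearP comp_lfunDl -comp_lfunZl linearP.
Qed.

Lemma homA_actE a f : vsval (homA_act a f) = (amulr a \o vsval f)%VF.
Proof.
rewrite homA_actP.2 vsprojK //; apply/mem_homspace => b m.
rewrite !comp_lfunE (proj1 (mem_homspace _) (subvsP f)) /=.
by rewrite !lfunE /= mulrA.
Qed.

Fact homA_act1 : homA_act 1 = \1%VF.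
Proof.
apply/lfunP=> f; apply: val_inj; rewrite /= homA_actE id_lfunE.
by apply/lfunP=> m; rewrite comp_lfunE lfunE /= mulr1.
Qed.

Fact homA_actM a b : homA_act (a * b) = (homA_act b \o homA_act a)%VF.
Proof.
apply/lfunP=> f; apply: val_inj; rewrite comp_lfunE /= !homA_actE.
by apply/lfunP=> m; rewrite !comp_lfunE !lfunE /= mulrA.
Qed.

Definition homA : fdrmodule := FDRModule homA_actP.1 homA_act1 homA_actM.
End HomToRegular.

(* Hom_A(p, A) : Hom_A(N, A) -> Hom_A(M, A). Only meaningful when p is a module
   homomorphism; see [homA_mapE]. *)
Definition homA_map (M N : fdmodule) (p : 'Hom(M, N)) :
    'Hom(homA N, homA M) :=
  linfun (fun f : subvs_of (homspace N regular_module) =>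
    vsproj (homspace M regular_module) (vsval f \o p)%VF).

Lemma homA_mapE (M N : fdmodule) (p : 'Hom(M, N)) (f : homA N) :
  is_hom p ->
  vsval (homA_map p f : subvs_of _) = (vsval (f : subvs_of _) \o p)%VF.
Proof.
move=> hp; rewrite /homA_map linfunE => [|c x y].
  rewrite vsprojK //; apply/mem_homspace => a m.
  by rewrite !comp_lfunE hp (proj1 (mem_homspace _) (subvsP f)).
by rewrite linearP comp_lfunDl -comp_lfunZl linearP.
Qed.

(* D T = Hom_k(T, k), with (a . phi)(t) = phi(t . a). *)
Section Dual.
Variable T : fdrmodule.

Definition dual_act (a : A) : 'End('Hom(T, k^o)) :=
  linfun (fun phi : 'Hom(T, k^o) => (phi \o ract T a)%VF).

Fact dual_actP : linear dual_act /\
  forall a phi, dual_act a phi = (phi \o ract T a)%VF.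
Proof.
apply: (act_linfun (F := fun a (phi : 'Hom(T, k^o)) => (phi \o ract T a)%VF)).
  by move=> a c x y; rewrite comp_lfunDl -comp_lfunZl.
by move=> x c a b; rewrite ract_linear comp_lfunDr -comp_lfunZr.
Qed.

Fact dual_act1 : dual_act 1 = \1%VF.
Proof. by apply/lfunP=> f; rewrite dual_actP.2 ract1 comp_lfun1r id_lfunE. Qed.

Fact dual_actM a b : dual_act (a * b) = (dual_act a \o dual_act b)%VF.
Proof.
by apply/lfunP=> f; rewrite comp_lfunE !dual_actP.2 ractM comp_lfunA.
Qed.

Definition dual : fdmodule := FDModule dual_actP.1 dual_act1 dual_actM.
End Dual.

Definition superfluous (M : fdmodule) (U : {vspace M}) : Prop :=
  forall V : {vspace M},
    is_submodule V -> (U + V)%VS = fullv -> V = fullv.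

(* P1 -p1-> P0 -p0-> M -> 0 is exact, and p0 and the corestriction
   P1 -> Ker p0 of p1 are projective covers. *)
Definition minimal_projective_presentation
    (P1 P0 M : fdmodule) (p1 : 'Hom(P1, P0)) (p0 : 'Hom(P0, M)) : Prop :=
  [/\ projective_module P1, projective_module P0 & is_hom p1 /\ is_hom p0] /\
  [/\ limg p0 = fullv, limg p1 = lker p0,
      superfluous (lker p0) & superfluous (lker p1)].

(* Tr M is determined up to isomorphism: [is_transpose M T] says that T is
   isomorphic to Tr M, the cokernel of Hom_A(p1, A). *)
Definition is_transpose (M : fdmodule) (T : fdrmodule) : Prop :=
  exists (P1 P0 : fdmodule) (p1 : 'Hom(P1, P0)) (p0 : 'Hom(P0, M)),
    minimal_projective_presentation p1 p0 /\
    exists q : 'Hom(homA P1, T),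
      [/\ is_rhom q, lker q = limg (homA_map p1) & limg q = fullv].

(* N is isomorphic to tau M, where tau = D Tr. *)
Definition is_AR_translate (M N : fdmodule) : Prop :=
  exists2 T : fdrmodule, is_transpose M T & fdmod_iso N (dual T).

(* N is isomorphic to tau^r M. *)
Fixpoint is_AR_iterate (r : nat) (M N : fdmodule) : Prop :=
  if r is r'.+1 then
    exists2 N' : fdmodule, is_AR_iterate r' M N' & is_AR_translate N' N
  else fdmod_iso N M.

Definition postinjective (M : fdmodule) : Prop :=
  indecomposable M /\
  exists (r : nat) (I : fdmodule),
    [/\ indecomposable I, injective_module I & is_AR_iterate r I M].

Definition hyperfinite (R : realType) (F : fdmodule -> Prop) : Prop :=
  forall eps : R, 0 < eps ->
  exists2 L : R, 0 < L &
  forall M : fdmodule, F M ->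
  exists (U : {vspace M}) (hU : is_submodule U),
    (1 - eps) * (\dim {:M})%:R <= (\dim U)%:R /\
    exists (t : nat) (N : 'I_t -> fdmodule),
      (forall i, (\dim {:N i})%:R <= L) /\
      fdmod_iso (submod hU) (\big[dsum/zero_module]_(i < t) N i).

End Modules.

Arguments postinjective {k A} M.
Arguments hyperfinite {k A} R F.

Section Kronecker.
Variables (k : fieldType) (d : nat).

(* The vertices 1 and 2 are encoded by [false] and [true]. The paths are the
   two trivial paths [inl v] and the d arrows [inr a]. *)
Definition kpath : finType := (bool + 'I_d)%type.

Definition kpath_source (p : kpath) : bool :=
  if p is inl v then v else false.

Definition kpath_target (p : kpath) : bool :=
  if p is inl v then v else true.

(* [kpath_comp q p] is the path "first p, then q". Two arrows are never
   composable, so that case is excluded by the test. *)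
Definition kpath_comp (q p : kpath) : option kpath :=
  if kpath_target p == kpath_source q then
    Some (if q is inl _ then p else q)
  else None.

(* The vector space with basis the paths. With the convention above, left
   modules over it are representations of the quiver. *)
Definition kronecker_algebra : Type := {ffun kpath -> k^o}.

HB.instance Definition _ := Vector.on kronecker_algebra.

Implicit Types x y z : kronecker_algebra.

Definition kron_mul x y : kronecker_algebra :=
  [ffun p => \sum_(q : kpath) \sum_(r : kpath | kpath_comp q r == Some p)
               x q * y r].

Definition kron_one : kronecker_algebra :=
  [ffun p : kpath => (if p is inl _ then 1 else 0) : k].

Lemma kpath_comp_vertex q r v :
  (kpath_comp q r == Some (inl v)) = (q == inl v) && (r == inl v).
Proof. by case: q r v => [[]|b] [[]|c] []. Qed.

Lemma kpath_comp_arrow q r a :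
  (kpath_comp q r == Some (inr a)) =
    (q == inl true) && (r == inr a) || (q == inr a) && (r == inl false).
Proof.
by case: q r => [[]|b] [[]|c] //; rewrite /kpath_comp /= ?andbF ?orbF ?andbT.
Qed.

Lemma kron_mul_vertex x y v : kron_mul x y (inl v) = x (inl v) * y (inl v).
Proof.
rewrite ffunE pair_big_dep (eq_bigl (pred1 (inl v, inl v))) ?big_pred1_eq //.
by move=> [q r] /=; rewrite kpath_comp_vertex xpair_eqE.
Qed.

Lemma kron_mul_arrow x y a :
  kron_mul x y (inr a) = x (inl true) * y (inr a) + x (inr a) * y (inl false).
Proof.
rewrite ffunE pair_big_dep (bigD1 (inl true, inr a)) /=; last first.
  by rewrite kpath_comp_arrow !eqxx.
congr (_ + _); rewrite (eq_bigl (pred1 (inr a, inl false))) ?big_pred1_eq //.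
move=> [q r] /=; rewrite kpath_comp_arrow !xpair_eqE.
by case: q r => [[]|b] [[]|c] //=; rewrite ?andbF ?orbF ?andbT ?andbN.
Qed.

Definition kron_mulE := (kron_mul_vertex, kron_mul_arrow).

Fact kron_mulA : associative kron_mul.
Proof.
move=> x y z; apply/ffunP=> -[v|a]; rewrite !kron_mulE ?mulrA //.
by rewrite mulrDr mulrDl !mulrA addrA.
Qed.

Fact kron_mul1r : left_id kron_one kron_mul.
Proof.
move=> x; apply/ffunP=> -[v|a]; rewrite !kron_mulE !ffunE !mul1r //.
by rewrite mul0r addr0.
Qed.

Fact kron_mulr1 : right_id kron_one kron_mul.
Proof.
move=> x; apply/ffunP=> -[v|a]; rewrite !kron_mulE !ffunE !mulr1 //.
by rewrite mulr0 add0r.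
Qed.

Fact kron_mulDl : left_distributive kron_mul +%R.
Proof.
move=> x y z; apply/ffunP=> -[v|a]; rewrite ?(kron_mulE, ffunE) !mulrDl //.
by rewrite addrACA.
Qed.

Fact kron_mulDr : right_distributive kron_mul +%R.
Proof.
move=> x y z; apply/ffunP=> -[v|a]; rewrite ?(kron_mulE, ffunE) !mulrDr //.
by rewrite addrACA.
Qed.

Fact kron_one_neq0 : kron_one != 0.
Proof.
by apply/eqP=> /ffunP/(_ (inl true)) /eqP; rewrite !ffunE oner_eq0.
Qed.

HB.instance Definition _ := GRing.Zmodule_isNzRing.Build kronecker_algebra
  kron_mulA kron_mul1r kron_mulr1 kron_mulDl kron_mulDr kron_one_neq0.

Fact kron_scalerAl (c : k) x y : c *: (x * y) = (c *: x) * y.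
Proof.
apply/ffunP=> -[v|a]; rewrite /GRing.mul/= ?(kron_mulE, ffunE) /GRing.scale /=.
  by rewrite mulrA.
by rewrite mulrDr !mulrA.
Qed.

HB.instance Definition _ :=
  GRing.Lmodule_isLalgebra.Build k kronecker_algebra kron_scalerAl.

Fact kron_scalerAr (c : k) x y : c *: (x * y) = x * (c *: y).
Proof.
apply/ffunP=> -[v|a]; rewrite /GRing.mul/= ?(kron_mulE, ffunE) /GRing.scale /=.
  by rewrite mulrCA.
by rewrite mulrDr; congr (_ + _); rewrite mulrCA.
Qed.

HB.instance Definition _ :=
  GRing.Lalgebra_isAlgebra.Build k kronecker_algebra kron_scalerAr.

HB.instance Definition _ := Algebra_isFalgebra.Build k kronecker_algebra.

End Kronecker.

(* Main.v *)
From HB Require Import structures.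
Require Import Defs.
From mathcomp Require Import all_boot all_order all_algebra all_field perm reals.

(* The modules tau^r I are obtained from (k, 0) and (k^d, k) by repeatedly taking
   the kernel K of V1^d -> V2 and passing from V1 => V2 to K => V1. Up to
   relabelling the arrows, the n-th one is T_n => T_(n-1), where T_n consists of
   the functions f on words of length n in the d letters such that the sum over i
   of f (a i phi(i) b) vanishes for all words a and b, and the i-th arrow sends f
   to f (i _). Here phi exchanges two letters D and F, which makes the words
   without factor DF coordinates on T_n.

   Inside this module, the functions with f (F^r _) = 0 form, together with
   T_(n-1), a submodule of codimension at most 2^-r dim T_n. It is the direct sum,
   over the words u of length n - r - 1, of the functions that are supported, in
   the above coordinates, on the words ending in u; each of these blocks has
   dimension at most d^(r+1) + d^r. *)

Set Implicit Arguments.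
Unset Strict Implicit.
Unset Printing Implicit Defensive.

Import Order.TTheory GRing.Theory Num.Theory.
Local Open Scope ring_scope.

(** * Words *)

(** The transposition avoids an overlap. Kernels of kernels naturally give the relations [\sum_i f
    (a ++ [:: i, i & b]) = 0], whose leading word [ii] overlaps itself, so that choosing coordinates
    would require a confluence check. With the twist the leading word is [DF], two distinct letters,
    and no check is left. Arrows delete the first letter, so sorting coordinates by their suffix
    looks compatible with them. The obstacle is that [D :: w] may fail to be normal for a normal
    [w]. Rewriting then moves [D] to the right past the leading [F]s of [w], and the suffix is
    endangered only if [D] passes [r] of them; it is then preceded by [F^r]. This is why exactly the
    values [f (F^r _)] are required to vanish. The price is small because a third letter [G] exists:
    both [F] and [G] can be put in front of any normal word, so prescribing [r] letters divides the
    count by at least [2^r]. For two letters the normal words are [F^a D^b], and this exponential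
    gain disappears; here [d >= 3] enters. *)

Section Words.
Variables (k : fieldType) (I : finType) (D F : I).
Hypothesis DF : D != F.

Local Notation phi := (tperm D F).

Definition normal_word : pred (seq I) :=
  sorted (fun i j => ~~ ((i == D) && (j == F))).
Arguments normal_word : simpl never.

(** Taking [f] on all words, with only the values at length [n] constrained, lets slices such as
    [f (i :: _)] be formed without dependent types. For [n < 2] the condition is empty. *)
Definition tensor_rel (n : nat) (f : seq I -> k) : Prop :=
  forall a b : seq I, (size a + size b).+2 = n ->
    \sum_i f (a ++ [:: i, phi i & b]) = 0.

Lemma tensor_rel_cons n f i :
  tensor_rel n.+1 f -> tensor_rel n (fun w => f (i :: w)).
Proof. by move=> hf a b hn; apply: (hf (i :: a) b); rewrite /= -hn. Qed.

Lemma tensor_rel_drop n f s :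
  tensor_rel (size s + n) f -> tensor_rel n (fun w => f (s ++ w)).
Proof.
by elim: s f => [|i s IH] f //= hf; apply: (IH (fun w => f (i :: w)));
   apply: tensor_rel_cons.
Qed.

Lemma tensor_rel_eq n f g :
  (forall w, size w = n -> f w = g w) -> tensor_rel n f -> tensor_rel n g.
Proof.
move=> fg hf a b hn; rewrite -[RHS](hf a b hn); apply: eq_bigr => i _.
by rewrite fg // size_cat /= !addnS.
Qed.

Lemma normal_consN i w : i != D -> normal_word (i :: w) = normal_word w.
Proof. by move=> /negPf iD; case: w => [|j w] //; rewrite /normal_word /= iD. Qed.

Lemma normal_consF w : normal_word (F :: w) = normal_word w.
Proof. by rewrite normal_consN // eq_sym. Qed.

Lemma normal_cat_nseqF t w : normal_word (nseq t F ++ w) = normal_word w.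
Proof. by elim: t => //= t IH; rewrite normal_consF. Qed.

Lemma normal_consD i w : i != F -> normal_word (D :: i :: w) = normal_word (i :: w).
Proof. by move=> /negPf iF; rewrite /normal_word /= iF andbF. Qed.

Lemma normal_tail i w : normal_word (i :: w) -> normal_word w.
Proof. by move/path_sorted. Qed.

Lemma tensor_relDF n f a b : (size a + size b).+2 = n -> tensor_rel n f ->
  f (a ++ [:: D, F & b]) = - \sum_(i | i != D) f (a ++ [:: i, phi i & b]).
Proof.
by move=> hn /(_ a b hn)/eqP; rewrite (bigD1 D) //= tpermL addr_eq0 => /eqP.
Qed.

(* The rewriting [DF -> - \sum_(i != D) i (phi i)] has no overlaps, so the words
   avoiding [DF] are coordinates on the tensors satisfying the relations. *)
Lemma tensor_normal_eq0 n f : tensor_rel n f ->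
  (forall w, size w = n -> normal_word w -> f w = 0) ->
  forall w, size w = n -> f w = 0.
Proof.
elim: n f => [|n IH] f hf f0; first by case=> // _; apply: f0.
have other i w : i != D -> size w = n -> f (i :: w) = 0.
  move=> iD; apply: (IH (fun w => f (i :: w))); first exact: tensor_rel_cons.
  by move=> v hv nv; rewrite f0 ?normal_consN //= hv.
case=> // i w [hw]; have [->|/other] := eqVneq i D; last exact.
apply: (IH (fun w => f (D :: w))) w hw; first exact: tensor_rel_cons.
case=> [|j w] hw nw; first by rewrite f0 //= -hw.
have [jF|jF] := eqVneq j F; last by rewrite f0 ?normal_consD //= -hw.
(* Every term on the right begins with a letter other than [D], where [f] is already known to
   vanish. *)
rewrite jF (@tensor_relDF n.+1 _ [::] w) //; last by rewrite /= -hw.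
by rewrite big1 ?oppr0 // => i' iD; rewrite other.
Qed.

(** The slices [f (i :: _)] are extended independently by induction. Only the slice at [D] needs
    care: its values on words beginning with [F] are forced by the relation on the first two
    letters, which is what [hD] records. *)
Lemma tensor_extend n (h : seq I -> k) :
  exists2 f, tensor_rel n f & forall w, size w = n -> normal_word w -> f w = h w.
Proof.
elim: n h => [|n IH] h; first by exists h.
have /fin_all_exists[g /all_and2[gT gE]] i : exists gi : seq I -> k,
    tensor_rel n gi /\
    forall w, size w = n -> normal_word w -> gi w = h (i :: w).
  by have [g gT gE] := IH (fun w => h (i :: w)); exists g.
pose hD w := if w is j :: b then
  if j == F then - \sum_(i | i != D) g i (phi i :: b) else h (D :: w)
  else h (D :: w).
have [gD gDT gDE] := IH hD.
pose f w := if w is i :: w' then if i == D then gD w' else g i w' else 0.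
have fi i : tensor_rel n (fun w => f (i :: w)) by rewrite /f; case: eqP.
exists f => [[|i a] b|]; last 2 first.
- by move=> [hn]; apply: (fi i a b).
- case=> // i w [hw] nw; rewrite /f; case: eqP nw => [->|/eqP iD] nw; last first.
    by rewrite gE //; apply: normal_tail nw.
  rewrite gDE //; last by apply: normal_tail nw.
  case: w hw nw => //= j w hw; case: eqP => [->|//].
  by rewrite /normal_word /= !eqxx.
- rewrite add0n => -[hn]; rewrite (bigD1 D) //= eqxx tpermL.
  rewrite (eq_bigr (fun i => g i (phi i :: b))) => [|i /negPf -> //].
  case: n hn {IH f fi} gT gE gDT gDE => // n [hn] gT gE gDT gDE.
  pose r w := gD (F :: w) + \sum_(i | i != D) g i (phi i :: w).
  (* By construction the relation on the first two letters holds only in front of normal words. Its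
     defect [r] satisfies the relations itself, so it vanishes in front of all words. *)
  suff /(_ b hn): forall w, size w = n -> r w = 0 by [].
  apply: tensor_normal_eq0 => [a c hac|w hw nw]; last first.
    by rewrite /r gDE ?normal_consF //= ?hw // eqxx addNr.
  rewrite /r big_split /= (gDT (F :: a) c) ?add0r /= -?hac //.
  rewrite exchange_big big1 // => i _.
  by apply: (gT i (phi i :: a) c); rewrite /= -hac.
Qed.

(* Pushing the letter D to the right through the relations only creates normal
   words with the same suffix, until the prefix is a power of F. *)
Lemma tensor_suffix_eq0 r l u f :
  tensor_rel (r + l).+1 f ->
  (forall c, size c = l.+1 -> f (nseq r F ++ c) = 0) ->
  (forall w, size w = (r + l).+1 -> normal_word w -> drop r.+1 w != u ->
     f w = 0) ->
  forall i w, size w = (r + l)%N -> normal_word w -> drop r w != u ->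
    f (i :: w) = 0.
Proof.
move=> hf fF f0 i w hw nw hu.
have [iD|iD] := eqVneq i D; last by rewrite f0 ?normal_consN //= hw.
have key c s t : (t + size c)%N = r -> size s = l -> normal_word (c ++ s) ->
    s != u -> f (nseq t F ++ D :: c ++ s) = 0.
  elim: c t => [|x c IH] t ht hs nc su.
    by rewrite -ht addn0 in fF; rewrite fF //= hs.
  have sz : size (nseq t F ++ D :: (x :: c) ++ s) = (r + l).+1.
    by rewrite size_cat size_nseq /= size_cat hs -ht /= !(addnS, addSn) addnA.
  have dr j1 j2 : drop r.+1 (nseq t F ++ [:: j1, j2 & c ++ s]) = s.
    rewrite -[_ :: _ :: _]/([:: j1, j2 & c] ++ s) catA drop_size_cat //.
    by rewrite size_cat size_nseq -ht /= !addnS.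
  have [xF|xF] := eqVneq x F; last first.
    by rewrite f0 ?normal_cat_nseqF ?normal_consD // dr.
  move: nc; rewrite xF => /normal_tail nc.
  rewrite (tensor_relDF _ hf); last first.
    by rewrite size_nseq size_cat hs -ht /= !(addnS, addSn) addnA.
  (* The term [j = F] is [FD]: the letter [D] has moved one place to the right. Every other term is
     [jj] with [j] neither [D] nor [F], which gives a normal word with the same suffix [s]. *)
  rewrite big1 ?oppr0 // => j jD; have [->|jF] := eqVneq j F.
    have -> X : nseq t F ++ F :: X = nseq t.+1 F ++ X.
      by rewrite !cat_nseq /ncons -iterSr.
    by rewrite tpermR IH // -ht /= addnS.
  rewrite tpermD 1?eq_sym // f0 ?dr //; last first.
    by rewrite normal_cat_nseqF !normal_consN.
  by rewrite -sz !size_cat.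
have hr : (r <= size w)%N by rewrite hw leq_addr.
rewrite iD -(cat_take_drop r w) (key _ _ 0) //=.
- by rewrite size_takel.
- by rewrite size_drop hw addKn.
- by rewrite cat_take_drop.
Qed.

(** A letter other than [D] cannot open a factor [DF], so [F] and [G] both extend any normal word on
    the left. *)
Lemma card_normal_double G n : G != D -> G != F ->
  (2 * #|[set w : n.-tuple I | normal_word w]| <=
     #|[set w : n.+1.-tuple I | normal_word w]|)%N.
Proof.
move=> GD GF; pose h (x : bool * n.-tuple I) := [tuple of (if x.1 then F else G) :: x.2].
rewrite -card_bool -cardsT -cardsX.
have hi : injective h.
  move=> [b w] [c v] /(congr1 val) /= E; have [bc /val_inj ->] := E.
  by congr pair; case: b bc {E}; case: c => //= E; move: GF; rewrite E eqxx.
rewrite -(card_imset _ hi); apply/subset_leq_card/subsetP => x /imsetP[[b w]].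
rewrite !inE /= => nw ->; rewrite /h /=.
by case: b; rewrite normal_consN // eq_sym.
Qed.

Lemma card_normal_exp G r l n : G != D -> G != F -> n = (r + l)%N ->
  (2 ^ r * #|[set w : l.-tuple I | normal_word w]| <=
     #|[set w : n.-tuple I | normal_word w]|)%N.
Proof.
move=> GD GF ->; elim: r => [|r IH]; first by rewrite mul1n.
apply: leq_trans (card_normal_double _ GD GF).
by rewrite expnS -mulnA leq_mul2l IH.
Qed.

Lemma card_normal_prefix r l n : n = (r + l)%N ->
  (#|[set w : n.-tuple I | normal_word w && (take r w == nseq r F)]|
     <= #|[set w : l.-tuple I | normal_word w]|)%N.
Proof.
move=> ->; pose h (w : l.-tuple I) : (r + l).-tuple I := [tuple of nseq r F ++ w].
rewrite -(card_imset [set w : l.-tuple I | normal_word w] (f := h)); last first.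
  move=> w v /(congr1 val)/eqP; rewrite eqseq_cat // => /andP[_ /eqP].
  exact: val_inj.
apply/subset_leq_card/subsetP => w; rewrite inE => /andP[nw /eqP tw].
have sz : size (drop r w) == l by rewrite size_drop size_tuple addKn.
apply/imsetP; exists (Tuple sz); last first.
  by apply: val_inj; rewrite /= -{1}tw cat_take_drop.
by rewrite inE /= -(normal_cat_nseqF r) -tw cat_take_drop.
Qed.

End Words.

(** * Linear forms and direct sums *)

Section LinearForms.
Variable k : fieldType.

Lemma separating_form (V : vectType k) (W : {vspace V}) (x : V) : x \notin W ->
  exists2 z : 'Hom(V, k^o), forall w, w \in W -> z w = 0 & z x != 0.
Proof.
move=> xW; pose y := x - projv W x.
have y0 : y != 0.
  by apply: contraNneq xW => /subr0_eq ->; rewrite memv_proj.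
have [i ci] : exists i, coord (vbasis {:V}) i y != 0.
  apply/existsP; apply: contraNT y0; rewrite negb_exists => /forallP c0.
  rewrite (coord_vbasis (memvf y)) big1 // => i _.
  by have /negPn/eqP -> := c0 i; rewrite scale0r.
pose c : 'Hom(V, k^o) := linfun (coord (vbasis {:V}) i : V -> k^o).
exists (c \o (\1 - projv W))%VF => [w wW|].
  by rewrite comp_lfunE add_lfunE opp_lfunE id_lfunE projv_id // subrr linear0.
by rewrite comp_lfunE add_lfunE opp_lfunE id_lfunE lfunE.
Qed.

Lemma form_eq0 (V : vectType k) (x : V) :
  (forall z : 'Hom(V, k^o), z x = 0) -> x = 0.
Proof.
move=> hx; apply/eqP/negPn/negP; rewrite -memv0 => /separating_form[z _].
by rewrite hx eqxx.
Qed.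

(** Reflexivity of finite dimensional spaces; it turns a functional on the transpose into vectors of
    the translate. *)
Lemma bidual_eval (V : vectType k) (L : 'Hom('Hom(V, k^o), k^o)) :
  exists v : V, forall z, L z = z v.
Proof.
pose b := vbasis {:V}.
pose c i : 'Hom(V, k^o) := linfun (coord b i : V -> k^o).
exists (\sum_(i < \dim {:V}) L (c i) *: b`_i) => z.
have {1}-> : z = \sum_(i < \dim {:V}) (z b`_i : k) *: c i.
  apply/lfunP => v; rewrite sum_lfunE {1}(coord_vbasis (memvf v)) linear_sum.
  by apply: eq_bigr => i _; rewrite linearZ scale_lfunE lfunE; apply: mulrC.
rewrite !linear_sum; apply: eq_bigr => i _; rewrite !linearZ; exact: mulrC.
Qed.

Lemma factor_through (U T W : vectType k) (q : 'Hom(U, T)) (th : 'Hom(U, W)) :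
  limg q = fullv -> (lker q <= lker th)%VS -> forall u, (th \o q^-1)%VF (q u) = th u.
Proof.
move=> qT hq u; apply/eqP; rewrite comp_lfunE -subr_eq0 -linearB -memv_ker.
by apply: (subvP hq); rewrite memv_ker linearB /= limg_lfunVK ?subrr // qT memvf.
Qed.

Section Annihilator.
Variables (V : vectType k) (J : finType) (z : J -> 'Hom(V, k^o)).
Implicit Type P : pred J.

Definition annihilator P : {vspace V} := (\bigcap_(j | P j) lker (z j))%VS.

Lemma annihilatorP P v :
  reflect (forall j, P j -> z j v = 0) (v \in annihilator P).
Proof.
rewrite memvE; apply: (iffP subv_bigcapP) => h j Pj; have := h j Pj.
  by rewrite -memvE memv_ker => /eqP.
by rewrite -memvE memv_ker => ->.
Qed.

Lemma dim_cap_annihilator (U : {vspace V}) P :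
  (\dim U <= \dim (U :&: annihilator P) + #|P|)%N.
Proof.
rewrite /annihilator -big_enum /= cardE.
elim: (enum P) U => [|j s IH] U; first by rewrite big_nil capvf addn0.
rewrite big_cons capvA /=; have := IH (U :&: lker (z j))%VS.
have := limg_ker_dim (z j) U; have := dimvS (subvf (z j @: U)%VS).
rewrite dimvf /= => h1 <- h2; rewrite addnS -addn1 leq_add //.
Qed.

Lemma card_le_dim P :
  (forall h : J -> k, exists v, forall j, P j -> z j v = h j) ->
  (#|P| <= \dim {:V})%N.
Proof.
move=> hP; pose K := {j | P j}.
pose L : 'Hom(V, {ffun K -> k^o}) :=
  linfun (fun v => [ffun j : K => z (val j) v : k^o]).
have LE v : L v = [ffun j : K => z (val j) v : k^o].
  by rewrite linfunE // => c x y; apply/ffunP => j; rewrite !ffunE linearP.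
have -> : #|P| = \dim {:{ffun K -> k^o}} by rewrite dimvf -(card_sig P) -[LHS]muln1.
have <- : limg L = fullv.
  apply/eqP; rewrite eqEsubv subvf; apply/subvP => h _.
  have [v hv] := hP (fun j => if insub j is Some j' then h j' else 0).
  apply/memv_imgP; exists v; rewrite ?memvf // LE; apply/ffunP => j.
  by rewrite ffunE hv ?(valP j) // valK.
by rewrite -(limg_ker_dim L fullv) leq_addl.
Qed.

End Annihilator.
End LinearForms.

Section DirectSums.
Variables (k : fieldType) (A : falgType k).
Implicit Types M N X : fdmodule A.

(** An isomorphism of [X] with the submodule [U], phrased inside the ambient [M], so that direct
    sums can be built by computing with subspaces of [M]. *)
Definition embeds_onto X M (U : {vspace M}) : Prop :=
  exists h : 'Hom(X, M), [/\ is_hom h, lker h = 0%VS & limg h = U].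

Lemma embeds_onto_iso M N : embeds_onto M (fullv : {vspace N}) -> fdmod_iso M N.
Proof.
case=> h [hh hi hs]; exists h => //; exists (h^-1)%VF => x.
  by rewrite lker0_lfunK ?hi.
by rewrite limg_lfunVK // hs memvf.
Qed.

Lemma iso_bij M N (f : 'Hom(M, N)) : bijective f -> lker f = 0%VS /\ limg f = fullv.
Proof.
move=> bf; split; first by apply/eqP/lker0P; apply: bij_inj.
case: bf => g _ fg; apply/eqP; rewrite eqEsubv subvf; apply/subvP => x _.
by rewrite -[x]fg memv_img ?memvf.
Qed.

Lemma iso_inv M N : fdmod_iso M N -> fdmod_iso N M.
Proof.
case=> f hf bf; have [kf lf] := iso_bij bf.
have fK x : f (f^-1%VF x) = x by rewrite limg_lfunVK // lf memvf.
have Kf x : f^-1%VF (f x) = x by rewrite lker0_lfunK ?kf.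
exists f^-1%VF; last by exists f.
by move=> a m; rewrite -{1}[m]fK -hf Kf.
Qed.

Lemma iso_trans M N X : fdmod_iso M N -> fdmod_iso N X -> fdmod_iso M X.
Proof.
case=> f hf bf [g hg bg]; exists (g \o f)%VF.
  by move=> a m; rewrite !comp_lfunE hf hg.
by apply: (eq_bij (bij_comp bg bf)) => x; rewrite /= comp_lfunE.
Qed.

Lemma embeds_submod M (U : {vspace M}) (hU : is_submodule U) :
  embeds_onto (submod hU) U.
Proof.
pose h : 'Hom(submod hU, M) := linfun (fun u : subvs_of U => vsval u).
have hE u : h u = vsval (u : subvs_of U) by rewrite linfunE.
exists h; split.
- by move=> a m; rewrite !hE; apply: submod_actE.
- by apply/eqP/lker0P => u v; rewrite !hE => /subvs_inj.
- apply/eqP; rewrite eqEsubv; apply/andP; split; apply/subvP => x.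
    by case/memv_imgP => u _ ->; rewrite hE subvsP.
  by move=> xU; apply/memv_imgP; exists (vsproj U x); rewrite ?memvf // hE vsprojK.
Qed.

Lemma embeds_submod_iso X M (U : {vspace M}) (hU : is_submodule U) :
  embeds_onto X U -> fdmod_iso (submod hU) X.
Proof.
case=> h [hh hi hs]; apply/iso_inv/embeds_onto_iso.
pose g : 'Hom(X, submod hU) := linfun (fun x => vsproj U (h x) : submod hU).
have gE x : g x = vsproj U (h x).
  by rewrite linfunE // => c y z; rewrite !linearP.
have hU' x : h x \in U by rewrite -hs memv_img ?memvf.
exists g; split.
- move=> a m; apply: subvs_inj.
  have gv x : vsval (g x : subvs_of U) = h x by rewrite gE vsprojK.
  apply: etrans (gv _) _; apply/esym/(etrans (submod_actE hU a (g m))).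
  by rewrite hh; congr (lact M a _); apply: gv.
- apply/eqP/lker0P => x y; rewrite !gE => /(congr1 vsval).
  by rewrite !vsprojK //; apply/lker0P; rewrite hi.
- apply/eqP; rewrite eqEsubv subvf; apply/subvP => u _.
  have [|x _ E] := @memv_imgP _ _ _ h (vsval (u : subvs_of U)) fullv _.
    by rewrite hs subvsP.
  by apply/memv_imgP; exists x; rewrite ?memvf // gE -E vsvalK.
Qed.

Lemma embeds_zero M : embeds_onto (zero_module A) (0%VS : {vspace M}).
Proof.
exists 0; split.
- by move=> a m; rewrite !zero_lfunE linear0.
- by apply/eqP/lker0P => x y _; rewrite [x]thinmx0 [y]thinmx0.
- by rewrite lim0g.
Qed.

Lemma embeds_dsum X Y M (U V : {vspace M}) :
  embeds_onto X U -> embeds_onto Y V -> (U :&: V = 0)%VS ->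
  embeds_onto (dsum X Y) (U + V)%VS.
Proof.
case=> f [hf fi fs] [g [hg gi gs]] UV.
pose h : 'Hom(dsum X Y, M) := linfun (fun x : X * Y => f x.1 + g x.2).
have hE (x : X * Y) : h x = f x.1 + g x.2.
  by rewrite linfunE // => c y z; rewrite /= !linearP scalerDr addrACA.
have fU x : f x \in U by rewrite -fs memv_img ?memvf.
have gV x : g x \in V by rewrite -gs memv_img ?memvf.
exists h; split.
- by move=> a x; rewrite !hE (proj2 (dsum_actP X Y) a x) /= hf hg linearD.
- apply/eqP; rewrite -subv0; apply/subvP => -[x y].
  rewrite memv_ker hE /= addr_eq0 => /eqP E.
  have : f x \in (U :&: V)%VS by rewrite memv_cap fU E memvN gV.
  rewrite UV memv0 => /eqP fx0; move/eqP: E; rewrite fx0 eq_sym oppr_eq0 => /eqP gy0.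
  have x0 : x \in lker f by rewrite memv_ker fx0.
  have y0 : y \in lker g by rewrite memv_ker gy0.
  by move: x0 y0; rewrite fi gi !memv0 => /eqP -> /eqP ->.
- apply/eqP; rewrite eqEsubv; apply/andP; split; apply/subvP => v.
    by case/memv_imgP => x _ ->; rewrite hE memv_add.
  case/memv_addP => u; rewrite -fs => /memv_imgP[x _ ->].
  case=> w; rewrite -gs => /memv_imgP[y _ ->] ->.
  by apply/memv_imgP; exists (x, y); rewrite ?memvf // hE.
Qed.

Lemma embeds_bigsum M t (W : 'I_t -> {vspace M}) (hW : forall i, is_submodule (W i)) :
  (forall w : 'I_t -> M, (forall i, w i \in W i) -> \sum_i w i = 0 ->
     forall i, w i = 0) ->
  embeds_onto (\big[@dsum k A/zero_module A]_(i < t) submod (hW i))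
    (\sum_(i < t) W i)%VS.
Proof.
elim: t W hW => [|t IH] W hW indep.
  by rewrite !big_ord0; apply: embeds_zero.
rewrite !big_ord_recl; apply: embeds_dsum; first exact: embeds_submod.
  apply: (IH (fun i => W (lift ord0 i)) (fun i => hW (lift ord0 i))) => w wW w0 i.
  pose w' j := if unlift ord0 j is Some j' then w j' else 0.
  have := indep w' _ _ (lift ord0 i); rewrite /w' liftK; apply.
    by move=> j; case: unliftP => [j' ->|->]; rewrite ?mem0v.
  rewrite big_ord_recl unlift_none add0r -[RHS]w0.
  by apply: eq_bigr => j _; rewrite liftK.
apply/eqP; rewrite -subv0; apply/subvP => x; rewrite memv_cap => /andP[x0].
case/memv_sumP => w wW xE; rewrite memv0.
(* A common element [x] of the first summand and the sum of the others gives a family with sum zero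
   once [-x] is put in the first place. *)
pose w' j := if unlift ord0 j is Some j' then w j' else - x.
have := indep w' _ _ ord0; rewrite /w' unlift_none => h.
rewrite -oppr_eq0 h //.
  by move=> j; case: unliftP => [j' ->|->]; rewrite ?memvN // wW.
rewrite big_ord_recl unlift_none xE addrC; apply/eqP; rewrite subr_eq0; apply/eqP.
by apply: eq_bigr => j _; rewrite liftK.
Qed.

Lemma embeds_finsum M (J : finType) (W : J -> {vspace M}) :
  (forall j, is_submodule (W j)) ->
  (forall w : J -> M, (forall j, w j \in W j) -> \sum_j w j = 0 ->
     forall j, w j = 0) ->
  exists (t : nat) (N : 'I_t -> fdmodule A),
    (forall i, exists j, \dim {:N i} = \dim (W j)) /\
    embeds_onto (\big[@dsum k A/zero_module A]_(i < t) N i) (\sum_j W j)%VS.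
Proof.
move=> hW indep; have hW' (i : 'I_#|J|) := hW (enum_val i).
exists #|J|, (fun i => submod (hW' i)); split.
  by move=> i; exists (enum_val i); rewrite dimvf.
rewrite (reindex _ (onW_bij _ (enum_val_bij J))) /=.
apply: embeds_bigsum => w wW w0 i; rewrite -[i]enum_valK.
apply: (indep (fun j => w (enum_rank j))) => [j|].
  by have := wW (enum_rank j); rewrite enum_rankK.
rewrite (reindex _ (onW_bij _ (enum_val_bij J))) -[RHS]w0.
by apply: eq_bigr => j _; rewrite enum_valK.
Qed.

Lemma indecomposable_split M (U V : {vspace M}) :
  is_submodule U -> is_submodule V -> indecomposable M ->
  (U + V = fullv)%VS -> (U :&: V = 0)%VS -> U = 0%VS \/ V = 0%VS.
Proof.
move=> hU hV [_ ind] UVf UV0.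
have /embeds_onto_iso/iso_inv/ind :
    embeds_onto (dsum (submod hU) (submod hV)) (fullv : {vspace M}).
  by rewrite -UVf; apply: embeds_dsum => //; apply: embeds_submod.
by rewrite !dimvf /= => -[/eqP|/eqP]; rewrite dimv_eq0 => /eqP; [left|right].
Qed.

Lemma hom_lker M N (f : 'Hom(M, N)) : is_hom f -> is_submodule (lker f).
Proof.
move=> hf a; apply/subvP => _ /memv_imgP[x xf ->].
by move: xf; rewrite !memv_ker hf => /eqP ->; rewrite linear0.
Qed.

Lemma hom_limg M N (f : 'Hom(M, N)) : is_hom f -> is_submodule (limg f).
Proof.
move=> hf a; apply/subvP => _ /memv_imgP[_ /memv_imgP[x _ ->] ->].
by rewrite -hf memv_img ?memvf.
Qed.

Lemma is_hom_comp M N X (f : 'Hom(M, N)) (g : 'Hom(N, X)) :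
  is_hom f -> is_hom g -> is_hom (g \o f)%VF.
Proof. by move=> hf hg a m; rewrite !comp_lfunE hf hg. Qed.

Lemma lact_mul M a b (m : M) : lact M (a * b) m = lact M a (lact M b m).
Proof. by rewrite lactM comp_lfunE. Qed.

Lemma submoduleP M (U : {vspace M}) :
  is_submodule U <-> forall a m, m \in U -> lact M a m \in U.
Proof.
split=> [hU a m mU|hU a]; first by apply: (subvP (hU a)); rewrite memv_img.
by apply/subvP => _ /memv_imgP[m mU ->]; apply: hU.
Qed.

End DirectSums.

(** * Modules over the Kronecker algebra *)

Section KroneckerModules.
Variables (k : fieldType) (d : nat).
Local Notation A := (kronecker_algebra k d).
Implicit Types M N : fdmodule A.

Definition path_elt (p : kpath d) : A := [ffun q => ((q == p)%:R : k)].

Lemma kron_addE (a b : A) p : (a + b) p = a p + b p.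
Proof. by rewrite ffunE. Qed.

Lemma kron_scaleE c (a : A) p : (c *: a) p = c * a p.
Proof. by rewrite ffunE. Qed.

Lemma path_eltM p q :
  path_elt p * path_elt q =
    if kpath_comp p q is Some r then path_elt r else 0.
Proof.
apply/ffunP => r; rewrite [LHS]ffunE /=.
rewrite (bigD1 p) //= [X in _ + X]big1 ?addr0 => [|p' /negPf p'p]; last first.
  by rewrite big1 // => q' _; rewrite ffunE p'p mul0r.
have -> : \sum_(q' | kpath_comp p q' == Some r) path_elt p p * path_elt q q'
  = (kpath_comp p q == Some r)%:R :> k.
  rewrite big_mkcond (bigD1 q) //= big1 ?addr0 => [|q' /negPf q'q]; last first.
    by case: ifP => // _; rewrite ![path_elt _ _]ffunE q'q mulr0.
  by rewrite ![path_elt _ _]ffunE !eqxx mulr1; case: ifP.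
case: (kpath_comp p q) => [s|]; last by rewrite ffunE.
by rewrite ffunE eq_sym.
Qed.

Lemma kron_basis (a : A) : a = \sum_p a p *: path_elt p.
Proof.
apply/ffunP => p; rewrite sum_ffunE (bigD1 p) //= big1 => [|q /negPf qp].
  by rewrite kron_scaleE ffunE eqxx mulr1 addr0.
by rewrite kron_scaleE ffunE eq_sym qp mulr0.
Qed.

Lemma kron_one_sum : 1 = path_elt (inl false) + path_elt (inl true) :> A.
Proof. by apply/ffunP => -[[]|i]; rewrite !ffunE ?add0r ?addr0. Qed.

Lemma big_kpath (V : zmodType) (f : kpath d -> V) :
  \sum_p f p = f (inl false) + f (inl true) + \sum_i f (inr i).
Proof.
by rewrite big_sumType /= big_bool; congr (_ + _); apply: addrC.
Qed.

Definition vtx M v (m : M) : M := lact M (path_elt (inl v)) m.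
Definition arr M i (m : M) : M := lact M (path_elt (inr i)) m.

Fact vtx_linear M v : linear (@vtx M v). Proof. exact: linearP. Qed.
HB.instance Definition _ M v :=
  GRing.isLinear.Build k M M *:%R (@vtx M v) (@vtx_linear M v).

Fact arr_linear M i : linear (@arr M i). Proof. exact: linearP. Qed.
HB.instance Definition _ M i :=
  GRing.isLinear.Build k M M *:%R (@arr M i) (@arr_linear M i).

Lemma lact_sum M (J : finType) (c : J -> A) m :
  lact M (\sum_j c j) m = \sum_j lact M (c j) m.
Proof.
elim/big_rec2: _ => [|i y1 y2 _ <-].
  by have := lact_lin (-1) 0 0 m; rewrite scaler0 addr0 scaleN1r addNr.
by have := lact_lin 1 (c i) y2 m; rewrite !scale1r.
Qed.

Lemma lactZ M c (a : A) (m : M) : lact M (c *: a) m = c *: lact M a m.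
Proof.
have := lact_lin c a 0 m; rewrite addr0 => ->; rewrite -[RHS]addr0; congr (_ + _).
by have := lact_lin (-1) 0 0 m; rewrite scaler0 addr0 scaleN1r addNr.
Qed.

Lemma lactE M (a : A) m :
  lact M a m = a (inl false) *: vtx false m + a (inl true) *: vtx true m
    + \sum_i a (inr i) *: arr i m.
Proof.
by rewrite {1}[a]kron_basis lact_sum (eq_bigr _ (fun p _ => lactZ _ _ _)) big_kpath.
Qed.

Lemma vtx_sum M (m : M) : m = vtx false m + vtx true m.
Proof.
rewrite -[LHS](id_lfunE m) -(lact1 M) kron_one_sum.
by have := lact_lin 1 (path_elt (inl false)) (path_elt (inl true)) m; rewrite !scale1r.
Qed.

Lemma lact0 M (m : M) : lact M 0 m = 0.
Proof. by have := lactZ 0 0 m; rewrite !scale0r. Qed.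

Lemma path_act M p q (m : M) : lact M (path_elt p) (lact M (path_elt q) m) =
  if kpath_comp p q is Some r then lact M (path_elt r) m else 0.
Proof. by rewrite -lact_mul path_eltM; case: kpath_comp => //; rewrite lact0. Qed.

Lemma vtx_vtx M v w (m : M) : vtx v (vtx w m) = if v == w then vtx v m else 0.
Proof. by rewrite /vtx path_act; case: v w => [] []. Qed.

Lemma arr_vtx M i v (m : M) : arr i (vtx v m) = if v then 0 else arr i m.
Proof. by rewrite /vtx /arr path_act; case: v. Qed.

Lemma vtx_arr M i v (m : M) : vtx v (arr i m) = if v then arr i m else 0.
Proof. by rewrite /vtx /arr path_act; case: v. Qed.

Lemma hom_path M N (f : 'Hom(M, N)) :
  (forall p m, f (lact M (path_elt p) m) = lact N (path_elt p) (f m)) -> is_hom f.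
Proof.
move=> fp a m; rewrite [a]kron_basis !lact_sum linear_sum.
by apply: eq_bigr => p _; rewrite !lactZ linearZ /= fp.
Qed.

(* The sums of values of the arrows form the radical of M. *)
Lemma superfluous_arr M (U : {vspace M}) : is_submodule U -> superfluous U ->
  forall x, x \in U -> exists y : 'I_d -> M, x = \sum_i arr i (y i).
Proof.
move=> /submoduleP hU sU x xU; pose W := (\sum_i limg (lact M (path_elt (inr i))))%VS.
suff : x \in W.
  case/memv_sumP => y yW ->; have /fin_all_exists[z zE] i : exists z, y i = arr i z.
    by have /memv_imgP[z _ ->] := yW i isT; exists z.
  by exists z; apply: eq_bigr.
have arrW i m : arr i m \in W.
  by apply: (subvP (sumv_sup i _ (subvv _))) => //; rewrite memv_img ?memvf.
rewrite [x]vtx_sum; suff hv v : vtx v x \in W by rewrite memvD.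
apply/negPn/negP => /separating_form[z zW zx].
pose e : 'End(M) := lact M (path_elt (inl v)).
have zarr i m : z (vtx v (arr i m)) = 0.
  by rewrite vtx_arr; case: (v); rewrite ?linear0 // zW.
have zact a m : z (vtx v (lact M a m)) = a (inl v) * z (vtx v m).
  rewrite lactE !linearD !linearZ linear_sum linear_sum.
  rewrite big1 ?addr0 => [|i _]; last by rewrite !linearZ /= zarr scaler0.
  by rewrite /= !vtx_vtx; case: (v); rewrite /= linear0 scaler0 ?add0r ?addr0.
(* This kernel is a submodule because [z] kills the values of the arrows, and [U] contains
   [vtx v x], which lies outside it. Superfluity of [U] then forces the contradiction. *)
have VT : lker (z \o e)%VF = fullv.
  apply: sU.
    apply/submoduleP => a m; rewrite !memv_ker !comp_lfunE => /eqP zm.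
    by rewrite zact [X in _ * X]zm mulr0.
  apply/eqP; rewrite eqEsubv subvf; apply/subvP => m _.
  pose c := z (vtx v m) / z (vtx v x).
  rewrite -[m](subrK (c *: vtx v x)) addrC memv_add ?memvZ ?hU //.
  rewrite memv_ker comp_lfunE -[e _]/(vtx v _) !linearB !linearZ /=.
  by rewrite vtx_vtx eqxx /c ?scalerN [_ *: z _]mulfVK ?subrr.
move: zx; have := memvf (vtx v x); rewrite -VT memv_ker comp_lfunE.
by rewrite -[e _]/(vtx v _) vtx_vtx eqxx => ->.
Qed.

Section Representation.
Variables (V1 V2 : vectType k) (B : 'I_d -> 'Hom(V1, V2)).

Definition rep_act (a : A) : 'End((V1 * V2)%type) :=
  linfun (fun x : V1 * V2 =>
    (a (inl false) *: x.1, a (inl true) *: x.2 + \sum_i a (inr i) *: B i x.1)).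

Fact rep_actP : linear rep_act /\ forall a x, rep_act a x =
  (a (inl false) *: x.1, a (inl true) *: x.2 + \sum_i a (inr i) *: B i x.1).
Proof.
apply: (act_linfun (A := A) (V := (V1 * V2)%type) (W := (V1 * V2)%type)
  (F := fun a x => (a (inl false) *: x.1,
    a (inl true) *: x.2 + \sum_i a (inr i) *: B i x.1))).
  move=> a c x y; congr pair => /=; first by rewrite scalerDr !scalerA mulrC.
  rewrite scalerDr [c *: (_ + _)]scalerDr !scalerA [c * _]mulrC -!addrA; congr (_ + _).
  rewrite addrCA; congr (_ + _).
  rewrite scaler_sumr -big_split; apply: eq_bigr => i _ /=.
  by rewrite linearP scalerDr !scalerA mulrC.
move=> x c a b; congr pair => /=; first by rewrite !ffunE scalerDl scalerA.
rewrite [c *: (_ + _)]scalerDr !ffunE scalerDl scalerA -!addrA; congr (_ + _).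
rewrite addrCA; congr (_ + _); rewrite scaler_sumr -big_split.
by apply: eq_bigr => i _; rewrite /= !ffunE scalerDl scalerA.
Qed.

Fact rep_act1 : rep_act 1 = \1%VF.
Proof.
apply/lfunP => -[x y]; rewrite rep_actP.2 !ffunE !scale1r big1 ?addr0 ?id_lfunE //.
by move=> i _; rewrite ffunE scale0r.
Qed.

Fact rep_actM a b : rep_act (a * b) = (rep_act a \o rep_act b)%VF.
Proof.
apply/lfunP => x; rewrite comp_lfunE !rep_actP.2 /= !kron_mulE !scalerA.
congr pair; rewrite scalerDr scalerA -addrA; congr (_ + _).
rewrite scaler_sumr -big_split; apply: eq_bigr => i _ /=.
by rewrite kron_mulE [B i (_ *: _)]linearZ /= !scalerA scalerDl.
Qed.

Definition rep_module : fdmodule A := FDModule rep_actP.1 rep_act1 rep_actM.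

Lemma rep_moduleE a (x : rep_module) : lact rep_module a x =
  (a (inl false) *: x.1, a (inl true) *: x.2 + \sum_i a (inr i) *: B i x.1).
Proof. exact: rep_actP.2. Qed.

Lemma rep_vtx v (x : rep_module) :
  vtx v x = if v then (0, x.2) else (x.1, 0).
Proof.
rewrite /vtx rep_moduleE big1 => [|i _]; last by rewrite ffunE scale0r.
by rewrite !ffunE; case: v; rewrite /= scale0r scale1r addr0.
Qed.

Lemma rep_arr i (x : rep_module) : arr i x = (0, B i x.1).
Proof.
rewrite /arr rep_moduleE !ffunE /= !scale0r add0r (bigD1 i) //= big1 => [|j ji].
  by rewrite addr0 ffunE eqxx scale1r.
by rewrite ffunE -[_ == _]/(j == i) (negPf ji) scale0r.
Qed.

Lemma rep_hom N (f1 : 'Hom(V1, N)) (f2 : 'Hom(V2, N)) :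
  (forall v, vtx false (f1 v) = f1 v) -> (forall v, vtx true (f2 v) = f2 v) ->
  (forall i v, arr i (f1 v) = f2 (B i v)) ->
  exists2 f : 'Hom(rep_module, N), is_hom f & forall x, f x = f1 x.1 + f2 x.2.
Proof.
move=> h1 h2 h12; pose f : 'Hom(rep_module, N) :=
  linfun (fun x : V1 * V2 => f1 x.1 + f2 x.2).
have fE (x : V1 * V2) : f x = f1 x.1 + f2 x.2.
  by rewrite linfunE // => c y z; rewrite /= !linearP scalerDr addrACA.
exists f => //; have vD v (m n : N) : vtx v (m + n) = vtx v m + vtx v n.
  exact: linearD.
have aD i (m n : N) : arr i (m + n) = arr i m + arr i n by exact: linearD.
apply: hom_path => -[v|i] x; rewrite -?[lact _ (path_elt (inl _)) _]/(vtx _ _);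
  rewrite -?[lact _ (path_elt (inr _)) _]/(arr _ _).
  rewrite rep_vtx !fE vD; rewrite -(h1 x.1) -(h2 x.2) !vtx_vtx.
  by case: v => /=; rewrite ?h1 ?h2 linear0 ?add0r ?addr0.
rewrite rep_arr !fE aD linear0 add0r h12 -(h2 x.2) -[arr i (vtx _ _)]/(arr i _).
by rewrite arr_vtx addr0.
Qed.

End Representation.

End KroneckerModules.

(** * Minimal presentations *)

Section Translate.
Variables (k : fieldType) (d : nat).
Local Notation A := (kronecker_algebra k d).
Implicit Types M N : fdmodule A.

(** Exactness of [0 -> U -> V^d -> W], with the maps given by their components. *)
Definition arrow_kernel (U V W : vectType k)
    (C : 'I_d -> 'Hom(U, V)) (B : 'I_d -> 'Hom(V, W)) : Prop :=
  [/\ forall u, (forall i, C i u = 0) -> u = 0,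
      forall u, \sum_i B i (C i u) = 0 &
      forall v : 'I_d -> V, \sum_i B i (v i) = 0 ->
        exists u, forall i, C i u = v i].

Lemma hom_vtx M N (f : 'Hom(M, N)) v m : is_hom f -> f (vtx v m) = vtx v (f m).
Proof. by move=> hf; apply: hf. Qed.

Lemma hom_arr M N (f : 'Hom(M, N)) i m : is_hom f -> f (arr i m) = arr i (f m).
Proof. by move=> hf; apply: hf. Qed.

Lemma vtx_false_rad M (y : 'I_d -> M) : vtx false (\sum_i arr i (y i)) = 0.
Proof. by rewrite linear_sum big1 // => i _; rewrite /= vtx_arr. Qed.

Lemma sum_pair0 (V W : vectType k) (f : 'I_d -> W) :
  \sum_i ((0, f i) : V * W) = (0, \sum_i f i).
Proof. by elim/big_rec2: _ => // i x y _ ->; congr pair; rewrite add0r. Qed.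

Section Free.
Variable V : vectType k.

(** With these maps as arrows, [V => V^d] is the projective [P(1) (x) V]; its universal property is
    [free_hom]. *)
Definition slot i : 'Hom(V, {ffun 'I_d -> V}) :=
  linfun (fun v => [ffun j => if j == i then v else 0]).

Lemma slotE i v : slot i v = [ffun j => if j == i then v else 0].
Proof.
rewrite linfunE // => c x y; apply/ffunP => j; rewrite !ffunE.
by case: ifP => // _; rewrite scaler0 addr0.
Qed.

Lemma sum_slot (y : {ffun 'I_d -> V}) : \sum_i slot i (y i) = y.
Proof.
apply/ffunP => j; rewrite sum_ffunE (bigD1 j) //= slotE ffunE eqxx big1 ?addr0 //.
by move=> i /negPf ij; rewrite slotE ffunE eq_sym ij.
Qed.

Lemma free_hom N (f : 'Hom(V, N)) : (forall v, vtx false (f v) = f v) ->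
  exists2 H : 'Hom(rep_module slot, N), is_hom H &
    forall x, H x = f x.1 + \sum_i arr i (f (x.2 i)).
Proof.
move=> hf; pose f2 : 'Hom({ffun 'I_d -> V}, N) :=
  linfun (fun y : {ffun 'I_d -> V} => \sum_i arr i (f (y i))).
have f2E y : f2 y = \sum_i arr i (f (y i)).
  rewrite linfunE // => c x z; rewrite scaler_sumr -big_split.
  by apply: eq_bigr => i _; rewrite !ffunE !linearP.
have [v|i v|H hH HE] := @rep_hom k d _ _ slot N f f2 hf.
- by rewrite f2E linear_sum; apply: eq_bigr => i _; rewrite /= vtx_arr.
- rewrite f2E slotE (bigD1 i) //= ffunE eqxx big1 ?addr0 // => j /negPf ji.
  by rewrite ffunE ji !linear0.
by exists H => // x; rewrite HE f2E.
Qed.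

End Free.

(* The presentation is P(2) (x) K -> P(1) (x) V1 with K the kernel of B: as
   Ker p0 lies in the radical of P0, which lives at vertex 2, P1 lives there too
   and p1 is injective, while P0 is free on V1 because it is projective. *)
Lemma presentation_rep (V1 V2 : vectType k) (B : 'I_d -> 'Hom(V1, V2))
    (P1 P0 : fdmodule A) (p1 : 'Hom(P1, P0)) (p0 : 'Hom(P0, rep_module B)) :
  (forall w, exists v, \sum_i B i (v i) = w) ->
  minimal_projective_presentation p1 p0 ->
  exists (s : 'Hom(V1, P0)) (p : 'I_d -> 'Hom(P1, V1)),
    [/\ arrow_kernel p B,
        forall x : P1, vtx false x = 0,
        forall x, p1 x = \sum_i arr i (s (p i x)) &
        forall N (f : 'Hom(V1, N)), (forall v, vtx false (f v) = f v) ->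
          exists2 F : 'Hom(P0, N), is_hom F & forall v, F (s v) = f v].
Proof.
move=> Bsurj [[_ P0proj [hp1 hp0]] [p0T p1K sup0 sup1]].
pose s : 'Hom(V1, P0) :=
  linfun (fun v => vtx false (p0^-1%VF ((v, 0) : rep_module B))).
have sE v : s v = vtx false (p0^-1%VF ((v, 0) : rep_module B)).
  rewrite linfunE // => c x y; rewrite -linearP -linearP; congr (vtx false (p0^-1%VF _)).
  by rewrite -[RHS]/(c *: x + y, c *: 0 + 0) scaler0 addr0.
have p0s v : p0 (s v) = (v, 0).
  by rewrite sE (hom_vtx _ _ hp0) limg_lfunVK ?rep_vtx // p0T memvf.
have s1 v : vtx false (s v) = s v by rewrite sE vtx_vtx eqxx.
have rad0 x : p0 x = 0 -> exists y : 'I_d -> P0, x = \sum_i arr i (y i).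
  move=> px; apply: (superfluous_arr (hom_lker hp0) sup0).
  by rewrite memv_ker px.
(* The difference lies in [Ker p0], hence in the radical, which has no component at vertex 1. *)
have v1E x : vtx false x = s (p0 x).1.
  apply/eqP; rewrite -subr_eq0; apply/eqP; set z := _ - _.
  have : p0 z = 0 by rewrite /z linearB /= (hom_vtx _ _ hp0) p0s rep_vtx subrr.
  case/rad0 => y zE; have : vtx false z = z by rewrite /z linearB /= vtx_vtx eqxx s1.
  by rewrite {1}zE vtx_false_rad.
have [G hG GE] := free_hom s1.
have p0arr (v : 'I_d -> V1) : p0 (\sum_i arr i (s (v i))) = (0, \sum_i B i (v i)).
  rewrite linear_sum -sum_pair0; apply: eq_bigr => i _.
  by rewrite /= (hom_arr _ _ hp0) p0s rep_arr.
(* Surjectivity of [B] allows the component at vertex 2 to be corrected into [Ker p0], hence into a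
   sum of values of arrows. An arrow only sees the component at vertex 1, which lies in the image of
   [s]. *)
have GT : limg G = fullv.
  apply/eqP; rewrite eqEsubv subvf; apply/subvP => x _.
  have [v vE] := Bsurj (p0 x).2.
  pose z := vtx true x - \sum_i arr i (s (v i)).
  have : p0 z = 0 by rewrite /z linearB /= p0arr (hom_vtx _ _ hp0) rep_vtx vE subrr.
  case/rad0 => y zE; apply/memv_imgP.
  exists ((p0 x).1, [ffun i => v i + (p0 (y i)).1]); rewrite ?memvf // GE /=.
  rewrite [LHS]vtx_sum v1E -[vtx true x](subrK (\sum_i arr i (s (v i)))) -/z.
  congr (_ + _); rewrite zE addrC -big_split; apply: eq_bigr => i _ /=.
  by rewrite ffunE !linearD /= -v1E arr_vtx.
have [h hh Gh] := P0proj _ _ G \1%VF hG GT (fun a m => etrans (id_lfunE _)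
  (congr1 _ (esym (id_lfunE _)))).
have hs v : h (s v) = ((v, 0) : rep_module (@slot V1)).
  have E : h (s v) = ((h (s v)).1, 0) by rewrite -{1}s1 (hom_vtx _ _ hh) rep_vtx.
  have : G (h (s v)) = s v by rewrite -comp_lfunE Gh id_lfunE.
  rewrite E GE /= big1 ?addr0 => [|i _]; last by rewrite ffunE !linear0.
  by move/(congr1 p0); rewrite !p0s => -[->].
(* Projectivity only gives [G h = 1]. As [h] takes each generator [s v] back to [(v, 0)], it is a
   left inverse of [G] as well. *)
have GK : lker G = 0%VS.
  apply/eqP; rewrite -subv0; apply/subvP => x; rewrite memv_ker memv0 => /eqP Gx.
  suff -> : x = h (G x) by rewrite Gx linear0.
  rewrite GE linearD /= hs linear_sum.
  transitivity ((x.1, 0) + \sum_i (0, slot V1 i (x.2 i)) : V1 * {ffun 'I_d -> V1}).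
    rewrite sum_pair0 sum_slot -[RHS]/(_ + 0, 0 + _) addr0 add0r.
    by case: (x).
  by congr (_ + _); apply: eq_bigr => i _; rewrite /= (hom_arr _ _ hh) hs rep_arr.
have Gv x : G (G^-1%VF x) = x by rewrite limg_lfunVK // GT memvf.
have vG x : G^-1%VF (G x) = x by rewrite lker0_lfunK ?GK.
have p01 x : p0 (p1 x) = 0.
  by apply/eqP; rewrite -memv_ker -p1K memv_img ?memvf.
have P1v x : vtx false (p1 x) = 0.
  by have [y ->] := rad0 _ (p01 x); apply: vtx_false_rad.
have rad1 x : p1 x = 0 -> exists y : 'I_d -> P1, x = \sum_i arr i (y i).
  move=> px; apply: (superfluous_arr (hom_lker hp1) sup1).
  by rewrite memv_ker px.
have P1f (x : P1) : vtx false x = 0.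
  have [|y E] := rad1 (vtx false x); first by rewrite (hom_vtx _ _ hp1) P1v.
  by rewrite -[LHS](vtx_vtx false false) E vtx_false_rad.
have p1i x : p1 x = 0 -> x = 0.
  by case/rad1 => y ->; apply: big1 => i _; rewrite -(arr_vtx i false) P1f linear0.
pose p i : 'Hom(P1, V1) :=
  linfun (fun x => (G^-1%VF (p1 x) : V1 * {ffun 'I_d -> V1}).2 i).
have pE i x : p i x = (G^-1%VF (p1 x) : V1 * {ffun 'I_d -> V1}).2 i.
  by rewrite linfunE // => c y z; rewrite !linearP /= !ffunE.
have p1E x : p1 x = \sum_i arr i (s (p i x)).
  have := P1v x; rewrite -{1}[p1 x]Gv GE linearD /= s1 vtx_false_rad addr0 => s0.
  by rewrite -[LHS]Gv GE s0 add0r; apply: eq_bigr => i _; rewrite pE.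
exists s, p; split=> //.
- split=> [u pu|u|v Bv].
  + by apply: p1i; rewrite p1E big1 // => i _; rewrite pu !linear0.
  + by have := p01 u; rewrite p1E p0arr => -[].
  + have : \sum_i arr i (s (v i)) \in lker p0 by rewrite memv_ker p0arr Bv.
    rewrite -p1K => /memv_imgP[u _ E]; exists u => i; rewrite pE -E.
    suff -> : \sum_i arr i (s (v i)) = G (0, [ffun i => v i]) by rewrite vG ffunE.
    by rewrite GE linear0 add0r; apply: eq_bigr => j _; rewrite ffunE.
- move=> N f hf; have [H hH HE] := free_hom hf.
  exists (H \o G^-1)%VF.
    move=> a m; rewrite !comp_lfunE -hH; congr (H _).
    by rewrite -{1}[m]Gv -hG vG.
  move=> v; rewrite comp_lfunE; suff -> : s v = G (v, 0).
    by rewrite vG HE /= big1 ?addr0 // => i _; rewrite ffunE !linear0.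
  by rewrite GE /= big1 ?addr0 // => i _; rewrite ffunE !linear0.
Qed.

End Translate.

(** * The translate *)

Section DualTranspose.
Variables (k : fieldType) (d : nat).
Local Notation A := (kronecker_algebra k d).
Implicit Types M N : fdmodule A.

Lemma regular_lactE (a b : A) : lact (regular_module A) a b = a * b.
Proof. exact: lfunE. Qed.

Lemma arrow_mulE i (a : A) : path_elt k (inr i) * a = a (inl false) *: path_elt k (inr i).
Proof.
apply/ffunP => -[v|j]; rewrite kron_scaleE [LHS]kron_mulE !ffunE /=.
  by rewrite mul0r mulr0.
by rewrite mul0r add0r mulrC.
Qed.

Lemma vtx_mulE v (a : A) w : (path_elt k (inl v) * a) (inl w) = (v == w)%:R * a (inl w).
Proof. by rewrite [LHS]kron_mulE ffunE eq_sym. Qed.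

(** * Homomorphisms to [A] from a module living at vertex 2 *)

Section HomFromSimple.
Variables (P : fdmodule A) (Pf : forall x : P, vtx false x = 0).

Lemma arr_simple i (x : P) : arr i x = 0.
Proof. by rewrite -(arr_vtx i false) Pf linear0. Qed.

Lemma vtx_simple (x : P) : vtx true x = x.
Proof. by rewrite [RHS]vtx_sum Pf add0r. Qed.

Fact form_smul_linear (c : kpath d) (z : 'Hom(P, k^o)) :
  linear (fun x => (z x : k) *: (path_elt k c : regular_module A)).
Proof. by move=> e x y; rewrite linearP scalerDl -scalerA. Qed.

(** The tensor of [z] and [c] in [Hom(P, A) = P^* (x) e_2 A]. Since [e_2 A] is spanned by the paths
    ending at vertex 2, it is meaningful only for such [c]. *)
Definition form_tensor (c : kpath d) (z : 'Hom(P, k^o)) : homA P :=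
  vsproj (homspace P (regular_module A))
    (linfun (fun x => (z x : k) *: (path_elt k c : regular_module A))).

Lemma form_tensorE c z x : kpath_target c ->
  vsval (form_tensor c z : subvs_of _) x = (z x : k) *: path_elt k c.
Proof.
move=> hc; have fE := linfunE (form_smul_linear c z).
rewrite /form_tensor vsprojK ?fE //; apply/mem_homspace; apply: hom_path => p m.
rewrite [RHS]regular_lactE !fE -scalerAr path_eltM; case: p => [[]|i].
- rewrite -[lact P _ m]/(vtx true m) vtx_simple; case: c hc {fE} => [[]|j] //.
- rewrite -[lact P _ m]/(vtx false m) Pf linear0 scale0r.
  by case: c hc {fE} => [[]|j] //=; rewrite scaler0.
- rewrite -[lact P _ m]/(arr i m) arr_simple linear0 scale0r.
  by case: c hc {fE} => [[]|j] //=; rewrite scaler0.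
Qed.

Lemma form_tensor_linear c : linear (form_tensor c).
Proof.
move=> e y z; rewrite /form_tensor -linearP; congr (vsproj _ _).
apply/lfunP => x; rewrite add_lfunE scale_lfunE.
rewrite !(linfunE (form_smul_linear c _)) add_lfunE scale_lfunE scalerDl.
by rewrite -scalerA.
Qed.

Definition form_coord (c : kpath d) (f : homA P) : 'Hom(P, k^o) :=
  linfun (fun x : P =>
    (vsval (f : subvs_of (homspace P (regular_module A))) x : A) c : k^o).

Lemma form_coordE c (f : homA P) x :
  form_coord c f x = (vsval (f : subvs_of _) x : A) c.
Proof. by rewrite linfunE // => e y z; rewrite linearP kron_addE kron_scaleE. Qed.

Lemma homA_decomp (f : homA P) :
  f = form_tensor (inl true) (form_coord (inl true) f)
    + \sum_i form_tensor (inr i) (form_coord (inr i) f).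
Proof.
apply: subvs_inj; apply/lfunP => x; rewrite linearD linear_sum add_lfunE sum_lfunE /=.
rewrite form_tensorE // form_coordE.
pose y : A := vsval (f : subvs_of _) x.
have y0 : y (inl false) = 0.
  suff -> : y = path_elt k (inl true) * y by rewrite vtx_mulE mul0r.
  rewrite -[RHS]regular_lactE -[RHS](proj1 (mem_homspace _) (subvsP _)).
  by rewrite -[lact P _ x]/(vtx true x) vtx_simple.
rewrite [LHS](kron_basis y) big_kpath y0 scale0r add0r; congr (_ + _).
by apply: eq_bigr => i _; rewrite form_tensorE // form_coordE.
Qed.

End HomFromSimple.

Section Dual.
Variables (P1 P0 : fdmodule A) (V1 : vectType k) (p1 : 'Hom(P1, P0)).
Variables (s : 'Hom(V1, P0)) (p : 'I_d -> 'Hom(P1, V1)).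
Variables (T : fdrmodule A) (q : 'Hom(homA P1, T)).
Hypotheses (Pf : forall x : P1, vtx false x = 0) (hp1 : is_hom p1).
Hypothesis p1E : forall x, p1 x = \sum_i arr i (s (p i x)).
Hypothesis free : forall N (f : 'Hom(V1, N)), (forall v, vtx false (f v) = f v) ->
  exists2 F : 'Hom(P0, N), is_hom F & forall v, F (s v) = f v.
Hypotheses (hq : is_rhom q) (qK : lker q = limg (homA_map p1)) (qT : limg q = fullv).

Let S : 'Hom({ffun 'I_d -> P1}, V1) :=
  linfun (fun y : {ffun 'I_d -> P1} => \sum_i p i (y i)).

Let SE y : S y = \sum_i p i (y i).
Proof.
rewrite linfunE // => c y1 y2; rewrite scaler_sumr -big_split.
by apply: eq_bigr => i _; rewrite !ffunE linearP.
Qed.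

Let L : vectType k := subvs_of (lker S).

Let b i : 'Hom(L, P1) := linfun (fun l : L => vsval (l : subvs_of (lker S)) i).

Let bE i l : b i l = vsval (l : subvs_of (lker S)) i.
Proof. by rewrite linfunE // => c x y; rewrite linearP !ffunE. Qed.

Let bker : arrow_kernel b p.
Proof.
split=> [u bu|u|v pv].
- by apply: subvs_inj; apply/ffunP => i; rewrite -bE bu linear0 ffunE.
- rewrite (eq_bigr (fun i => p i (vsval (u : subvs_of (lker S)) i))) => [|i _].
    by rewrite -SE; apply/eqP; rewrite -memv_ker subvsP.
  by rewrite bE.
- have vS : [ffun i => v i] \in lker S.
    rewrite memv_ker SE -[X in _ == X]pv; apply/eqP.
    by apply: eq_bigr => i _; rewrite ffunE.
  by exists (Subvs vS) => i; rewrite bE ffunE.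
Qed.

(** The pairing of [L + P1] with [P1^* (x) e_2 A]: the summand [P1] is evaluated against the
    coefficient of the trivial path, and [L], a subspace of [P1^d], against those of the arrows. As
    [T] is a cokernel, its dual consists of the functionals that vanish on the image of
    [homA_map p1]. *)
Let theta (x : rep_module b) : 'Hom(homA P1, k^o) :=
  linfun (fun f => form_coord (inl true) f x.2
                   + \sum_i form_coord (inr i) f (b i x.1)).

Let thetaE x f : theta x f =
  form_coord (inl true) f x.2 + \sum_i form_coord (inr i) f (b i x.1).
Proof.
rewrite linfunE // => c y z.
have lin e w : form_coord e (c *: y + z) w = c *: form_coord e y w + form_coord e z w.
  by rewrite !form_coordE linearP add_lfunE scale_lfunE kron_addE kron_scaleE.
rewrite lin scalerDr scaler_sumr -!addrA; congr (_ + _).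
rewrite addrCA; congr (_ + _); rewrite -big_split.
by apply: eq_bigr => i _; rewrite lin.
Qed.

Let hom_p1 N (g : 'Hom(P0, N)) x : is_hom g -> g (p1 x) = \sum_i arr i (g (s (p i x))).
Proof.
by move=> hg; rewrite p1E linear_sum; apply: eq_bigr => i _; rewrite /= (hom_arr _ _ hg).
Qed.

Let homA_p1 (g : homA P0) x :
  vsval (homA_map p1 g : subvs_of _) x =
    \sum_i (vsval (g : subvs_of _) (s (p i x)) : A) (inl false) *: path_elt k (inr i).
Proof.
rewrite homA_mapE // comp_lfunE hom_p1; last exact: (proj1 (mem_homspace _) (subvsP _)).
by apply: eq_bigr => i _; rewrite /arr regular_lactE arrow_mulE.
Qed.

Let sum_arrow (c : 'I_d -> k) e : (\sum_i c i *: path_elt k (inr i) : A) e =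
  if e is inr j then c j else 0.
Proof.
rewrite sum_ffunE; case: e => [v|j].
  by rewrite big1 // => i _; rewrite kron_scaleE ffunE mulr0.
rewrite (bigD1 j) //= kron_scaleE ffunE eqxx mulr1 big1 ?addr0 // => i /negPf ij.
by rewrite kron_scaleE ffunE -[_ == _]/(j == i) eq_sym ij mulr0.
Qed.

(** On the image of [g] the pairing is the [e_1]-coefficient of [g (s (\sum_i p i (b i x.1)))], and
    that sum is zero on [L]. *)
Let theta_ker x : (lker q <= lker (theta x))%VS.
Proof.
rewrite qK; apply/subvP => _ /memv_imgP[g _ ->]; rewrite memv_ker thetaE.
rewrite form_coordE homA_p1 sum_arrow add0r.
rewrite (eq_bigr (fun i => (vsval (g : subvs_of _) (s (p i (b i x.1))) : A) (inl false))).
  have E (a : 'I_d -> A) : \sum_i a i (inl false) = (\sum_i a i : A) (inl false).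
    by rewrite sum_ffunE.
  rewrite (E (fun i => vsval (g : subvs_of _) (s (p i (b i x.1))))).
  by rewrite -!linear_sum; case: bker => _ -> _; rewrite !linear0 ffunE.
by move=> i _; rewrite form_coordE homA_p1 sum_arrow.
Qed.

Let psi (x : rep_module b) : dual T := (theta x \o q^-1)%VF.

Let psiE x f : psi x (q f) = theta x f.
Proof. exact: factor_through. Qed.

Let qsurj t : exists f, t = q f.
Proof.
have /memv_imgP[f _ ->] : t \in limg q by rewrite qT memvf.
by exists f.
Qed.

Let psi_linear : linear psi.
Proof.
move=> c x y; apply/lfunP => t; have [f ->] := qsurj t.
rewrite add_lfunE scale_lfunE !psiE !thetaE !linearP scalerDr.
rewrite scaler_sumr -!addrA; congr (_ + _).
rewrite addrCA; congr (_ + _); rewrite -big_split.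
by apply: eq_bigr => i _; rewrite !linearP.
Qed.

Let Psi : 'Hom(rep_module b, dual T) := linfun psi.

Let PsiE x f : (Psi x : 'Hom(T, k^o)) (q f) =
  form_coord (inl true) f x.2 + \sum_i form_coord (inr i) f (b i x.1).
Proof. by rewrite linfunE // psiE thetaE. Qed.

Let Psi_hom : is_hom Psi.
Proof.
move=> a x; apply/lfunP => t; have [f ->] := qsurj t.
rewrite [lact (dual T) a _](proj2 (dual_actP T)) comp_lfunE -hq !PsiE rep_moduleE /=.
have cE c y : form_coord c (ract (homA P1) a f) y = (vsval (f : subvs_of _) y * a : A) c.
  rewrite form_coordE [vsval _]homA_actE comp_lfunE.
  by have -> (u : A) : amulr a u = u * a by rewrite lfunE.
rewrite cE [in RHS]kron_mulE -form_coordE linearD linearZ linear_sum /=.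
rewrite -addrA; congr (_ + _); first exact: mulrC.
rewrite -big_split; apply: eq_bigr => i _; rewrite cE kron_mulE -!form_coordE /=.
by rewrite !linearZ /=; congr (_ + _); apply: mulrC.
Qed.

Let Psi_inj : lker Psi = 0%VS.
Proof.
apply/eqP; rewrite -subv0; apply/subvP => x; rewrite memv_ker memv0 => /eqP Px.
have PE f : form_coord (inl true) f x.2 + \sum_i form_coord (inr i) f (b i x.1) = 0.
  by rewrite -PsiE Px zero_lfunE.
have cE c e (z : 'Hom(P1, k^o)) y : kpath_target c ->
    form_coord e (form_tensor c z) y = (c == e)%:R * z y :> k.
  move=> hc; rewrite form_coordE (form_tensorE Pf) //.
  rewrite -[LHS]/(((z y : k) *: path_elt k c : A) e) kron_scaleE ffunE mulrC.
  by rewrite eq_sym.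
have x2 : x.2 = 0.
  apply: form_eq0 => z; have := PE (form_tensor (inl true) z).
  rewrite cE // eqxx mul1r big1 ?addr0 // => i _.
  by rewrite cE // mul0r.
have x1 : x.1 = 0.
  case: bker => + _ _; apply => i; apply: form_eq0 => z.
  have := PE (form_tensor (inr i) z).
  rewrite cE // mul0r add0r (bigD1 i) //= cE // eqxx mul1r big1 ?addr0 // => j ji.
  by rewrite cE // -[_ == _]/(i == j) eq_sym (negPf ji) mul0r.
by rewrite [x]surjective_pairing x1 x2.
Qed.

Let Psi_surj : limg Psi = fullv.
Proof.
apply/eqP; rewrite eqEsubv subvf; apply/subvP => f _.
(* By reflexivity, [f] yields one vector of [P1] for each path: [y] for the trivial path and [w i]
   for the arrows. It remains to see that [w] lies in [L]. *)
have ev c : exists y, forall z, (f : 'Hom(T, k^o)) (q (form_tensor c z)) = z y.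
  pose Lm : 'Hom('Hom(P1, k^o), k^o) :=
    linfun (fun z => (f : 'Hom(T, k^o)) (q (form_tensor c z))).
  have [y yE] := bidual_eval Lm; exists y => z.
  by rewrite -yE linfunE // => e u v; rewrite form_tensor_linear !linearP.
have [y yE] := ev (inl true).
have /fin_all_exists[w wE] i := ev (inr i).
have pw : \sum_i p i (w i) = 0.
  apply: form_eq0 => z.
  pose g : homA P1 := \sum_i form_tensor (inr i) (z \o p i)%VF.
  transitivity ((f : 'Hom(T, k^o)) (q g)).
    rewrite /g !linear_sum; apply: eq_bigr => i _.
    by rewrite [RHS]wE comp_lfunE.
  suff : g \in lker q by rewrite memv_ker => /eqP ->; rewrite linear0.
  (* Freeness of [P0] extends [s v |-> z(v) e_1] to a homomorphism to [A]. Its composite with [p1]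
     is [g], so [q] kills [g]. *)
  pose h : 'Hom(V1, regular_module A) :=
      linfun (fun v => (z v : k) *: (path_elt k (inl false) : regular_module A)).
  have hE v : h v = (z v : k) *: path_elt k (inl false).
    by rewrite linfunE // => e u1 u2; rewrite linearP scalerDl -scalerA.
  have [v|F hF FE] := @free (regular_module A) h.
    by rewrite /vtx regular_lactE hE -scalerAr path_eltM.
  rewrite qK; apply/memv_imgP; exists (vsproj (homspace P0 (regular_module A)) F).
    exact: memvf.
  apply: subvs_inj; apply/lfunP => x; rewrite [RHS]homA_p1 linear_sum sum_lfunE /=.
  apply: eq_bigr => i _; rewrite vsprojK; last exact: (proj2 (mem_homspace F) hF).
  by rewrite form_tensorE // comp_lfunE FE hE kron_scaleE ffunE eqxx mulr1.
have [_ _ /(_ w pw)[l lE]] := bker.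
apply/memv_imgP; exists (l, y); rewrite ?memvf //.
apply/lfunP => t; have [g ->] := qsurj t; rewrite PsiE /=.
rewrite [in LHS](homA_decomp Pf g) !linearD !linear_sum /= yE; congr (_ + _).
by apply: eq_bigr => i _; rewrite wE lE.
Qed.

Lemma dual_transpose_rep : exists (L' : vectType k) (b' : 'I_d -> 'Hom(L', P1)),
  arrow_kernel b' p /\ fdmod_iso (dual T) (rep_module b').
Proof.
exists L, b; split=> //; apply/iso_inv/embeds_onto_iso.
by exists Psi.
Qed.

End Dual.

(** One translation is two kernel steps, from [B] to [p] and from [p] to [b]: the first comes from
    the presentation, the second from dualising the transpose. *)
Lemma AR_translate_rep (V1 V2 : vectType k) (B : 'I_d -> 'Hom(V1, V2)) M N :
  (forall w, exists v, \sum_i B i (v i) = w) -> fdmod_iso M (rep_module B) ->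
  is_AR_translate M N ->
  exists (K L : vectType k) (p : 'I_d -> 'Hom(K, V1)) (b : 'I_d -> 'Hom(L, K)),
    [/\ arrow_kernel p B, arrow_kernel b p & fdmod_iso N (rep_module b)].
Proof.
move=> Bsurj [g hg bg] [T [P1 [P0 [p1 [p0 [pres [q [hq qK qT]]]]]]] NT].
have [gK gT] := iso_bij bg.
have pres' : minimal_projective_presentation p1 (g \o p0)%VF.
  case: pres => -[proj1 proj0 [hp1 hp0]] [p0T p1K sup0 sup1].
  have kE : lker (g \o p0)%VF = lker p0.
    apply/vspaceP => x; rewrite !memv_ker comp_lfunE.
    apply/eqP/eqP => [/eqP|->]; last exact: linear0.
    by rewrite -memv_ker gK memv0 => /eqP.
  split; split=> //; rewrite ?kE //.
    by split=> //; apply: is_hom_comp.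
  by rewrite limg_comp p0T.
have [s [p [pK Pf p1E free]]] := presentation_rep Bsurj pres'.
have hp1 : is_hom p1 by case: pres => -[_ _ []].
have [L [b [bK iso]]] := dual_transpose_rep Pf hp1 p1E free hq qK qT.
by exists P1, L, p, b; split=> //; apply: iso_trans NT iso.
Qed.

End DualTranspose.

(** * Postinjective modules *)

Section Model.
Variables (k : fieldType) (d : nat) (D F : 'I_d).
Hypothesis DF : D != F.
Local Notation A := (kronecker_algebra k d).
Implicit Types M N : fdmodule A.

(** An isomorphism of [V] with the space [T_n], given by the forms [g w] that read off the value at
    [w]: they satisfy the relations, separate points and take all admissible values. *)
Definition tensor_coords (n : nat) (V : vectType k) (g : seq 'I_d -> 'Hom(V, k^o)) :
    Prop :=
  [/\ forall v, tensor_rel D F n (fun w => g w v),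
      forall v, (forall w, size w = n -> g w v = 0) -> v = 0 &
      forall f : seq 'I_d -> k, tensor_rel D F n f ->
        exists v, forall w, size w = n -> g w v = f w].

(** The module [T_n => T_(n-1)], with the convention [T_(-1) = 0] for [n = 0]. *)
Definition tensor_model (n : nat) (V1 V2 : vectType k)
    (B : 'I_d -> 'Hom(V1, V2)) : Prop :=
  exists (sg : {perm 'I_d}) (g1 : seq 'I_d -> 'Hom(V1, k^o))
         (g2 : seq 'I_d -> 'Hom(V2, k^o)),
    [/\ forall w i v, (size w).+1 = n -> g2 w (B (sg i) v) = g1 (i :: w) v,
        tensor_coords n g1 &
        if n is m.+1 then tensor_coords m g2 else forall v : V2, v = 0].

(* The relabelling of the arrows absorbs the twist by the transposition, so that
   kernels of arrows correspond to the twisted relations. *)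
Lemma tensor_model_kernel n (U V W : vectType k) (C : 'I_d -> 'Hom(U, V))
    (B : 'I_d -> 'Hom(V, W)) :
  arrow_kernel C B -> tensor_model n B -> tensor_model n.+1 C.
Proof.
move=> [Cinj BC Cker] [sg [g1 [g2 [g21 [g1T g1inj g1onto] g2c]]]].
pose sg' := (tperm D F * sg)%g.
have sg'E i : sg' i = sg (tperm D F i) by rewrite permM.
pose g w := if w is i :: w' then (g1 w' \o C (sg' i))%VF else 0.
exists sg', g, g1; split=> //.
  by move=> w i v _; rewrite /= comp_lfunE.
split.
- move=> u [|i a] b; last first.
    move=> [hn]; rewrite -[RHS](g1T (C (sg' i) u) a b hn).
    by apply: eq_bigr => j _; rewrite /= comp_lfunE.
  rewrite add0n => -[hn]; rewrite -[RHS](linear0 (g2 b)) -(BC u) linear_sum.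
  rewrite [RHS](reindex_perm sg) (reindex_perm (tperm D F)) /=.
  apply: eq_bigr => i _; rewrite comp_lfunE sg'E tpermK g21 //.
- move=> u gu; apply: Cinj => i; apply: g1inj => w hw.
  have := gu (sg'^-1%g i :: w); rewrite /= comp_lfunE permKV; apply.
  by rewrite hw.
- move=> f fT; have fi i : exists v, forall w, size w = n ->
      g1 w v = f (sg'^-1%g i :: w).
    by apply: g1onto; apply: tensor_rel_cons.
  have [v vE] := fin_all_exists fi.
  have Bv : \sum_i B i (v i) = 0.
    case: n => [|n] in g21 g2c g1T g1inj g1onto fT fi vE *; first exact: g2c.
    case: g2c => _ g2inj _; apply: g2inj => w hw.
    rewrite linear_sum (reindex_perm sg) (reindex_perm (tperm D F)) /=.
    rewrite -[RHS](fT [::] w) ?hw //; apply: eq_bigr => i _.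
    by rewrite g21 ?hw // vE /= ?hw // -sg'E permK.
  have [u uE] := Cker v Bv; exists u => -[|i w] //= [hw].
  by rewrite comp_lfunE uE vE // permK.
Qed.

(** The single arrow [sg F] is already onto: [F :: y] is normal whenever [y] is, so the values
    [f (F :: y)] at normal [y] can be prescribed freely. Each translation step needs this
    surjectivity. *)
Lemma tensor_model_onto n (V1 V2 : vectType k) (B : 'I_d -> 'Hom(V1, V2)) :
  tensor_model n B -> forall w, exists v, \sum_i B i (v i) = w.
Proof.
case=> sg [g1 [g2 [g21 [g1T g1inj g1onto] g2c]]] w.
case: n => [|n] in g21 g2c g1T g1inj g1onto *.
  by exists (fun _ => 0); rewrite [RHS]g2c.
have [f fT fE] := tensor_extend DF n.+1
  (fun y => if y is i :: y' then g2 y' w else 0 : k).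
have [v vE] := g1onto f fT; case: g2c => g2T g2inj _.
exists (fun i => if i == sg F then v else 0); rewrite (bigD1 (sg F)) //= eqxx.
rewrite big1 ?addr0 => [|i /negPf ->]; last exact: linear0.
apply/eqP; rewrite -subr_eq0; apply/eqP/g2inj.
apply: (tensor_normal_eq0 (g2T (B (sg F) v - w))) => y hy ny.
by rewrite linearB /= g21 ?hy // vE ?fE ?normal_consF /= ?hy ?subrr.
Qed.

Lemma tensor_model_point :
  tensor_model 0 (fun _ : 'I_d => 0 : 'Hom(k^o, 'rV[k]_0)).
Proof.
exists 1%g, (fun _ => \1%VF), (fun _ => 0); split=> //; last by move=> v; apply: thinmx0.
split=> // [v v0|f _]; first by rewrite -[LHS](id_lfunE v) (v0 [::]).
by exists (f [::]) => w /size0nil ->; rewrite id_lfunE.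
Qed.

Definition coord_fun (i : 'I_d) : 'Hom({ffun 'I_d -> k^o}, k^o) :=
  linfun (fun u : {ffun 'I_d -> k^o} => u i).

Lemma coord_funE i u : coord_fun i u = u i.
Proof. by rewrite linfunE // => c x y; rewrite !ffunE. Qed.

Lemma tensor_model_coord : tensor_model 1 coord_fun.
Proof.
apply: tensor_model_kernel tensor_model_point; split=> [u u0|u|v _].
- by apply/ffunP => i; rewrite -coord_funE u0 ffunE.
- by apply: thinmx0.
- by exists [ffun i => v i] => i; rewrite coord_funE ffunE.
Qed.

Lemma linear_smul (V : vectType k) (x : V) : linear (fun c : k^o => (c : k) *: x).
Proof. by move=> a b c; rewrite scalerDl -scalerA. Qed.

(** If vertex 2 acts by zero, every subspace is a submodule and [M] is a line, [I(1)]. Otherwise a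
    nonzero [x] at vertex 2 produces a copy of [I(2) = (k^d, k)] that splits off, so [M] is
    [I(2)]. *)
Lemma injective_model M : indecomposable M -> injective_module M ->
  exists (n : nat) (V1 V2 : vectType k) (B : 'I_d -> 'Hom(V1, V2)),
    fdmod_iso M (rep_module B) /\ tensor_model n B.
Proof.
move=> indM injM; have [dM _] := indM.
have [E0|] := eqVneq (limg (lact M (path_elt k (inl true)))) 0%VS.
  have v0 (x : M) : vtx true x = 0.
    apply/eqP; rewrite -memv0 -E0 memv_img ?memvf //.
  have a0 i (x : M) : arr i x = 0 by rewrite -[LHS](vtx_arr i true) v0.
  have actE a (x : M) : lact M a x = a (inl false) *: x.
    rewrite lactE v0 scaler0 addr0 big1 ?addr0 => [|i _]; last by rewrite a0 scaler0.
    by rewrite [in RHS](vtx_sum x) v0 addr0.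
  have sub (U : {vspace M}) : is_submodule U.
    by apply/submoduleP => a m mU; rewrite actE memvZ.
  pose x := vpick {:M}; have x0 : x != 0 by rewrite vpick0 -dimv_eq0.
  have xf : <[x]>%VS = fullv.
    have [||E|E] := indecomposable_split (sub <[x]>%VS) (sub <[x]>^C%VS) indM.
    - exact: addv_complf.
    - exact: capv_compl.
    - by have := memv_line x; rewrite E memv0 (negPf x0).
    - by rewrite -(addv_complf <[x]>%VS) E addv0.
  exists 0%N, k^o, 'rV[k]_0, (fun=> 0); split; last exact: tensor_model_point.
  pose f1 : 'Hom(k^o, M) := linfun (fun c : k^o => (c : k) *: x).
  have f1E c : f1 c = (c : k) *: x by rewrite (linfunE (linear_smul x)).
  have [v|v|i v|h hh hE] := @rep_hom k d k^o 'rV[k]_0 (fun=> 0) M f1 0.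
  - by rewrite [RHS]vtx_sum v0 addr0.
  - by rewrite zero_lfunE linear0.
  - by rewrite a0 zero_lfunE.
  apply/iso_inv/embeds_onto_iso; exists h; split=> //.
    apply/eqP; rewrite -subv0; apply/subvP => -[c v].
    rewrite memv_ker hE /= zero_lfunE addr0 f1E scaler_eq0 (negPf x0) orbF => /eqP /= ->.
    by rewrite [v]thinmx0 memv0.
  apply/eqP; rewrite eqEsubv subvf -xf; apply/subvP => _ /vlineP[c ->].
  apply/memv_imgP; exists (c : k^o, 0); rewrite ?memvf //.
  by rewrite hE /= zero_lfunE addr0 f1E.
rewrite -subv0 => /subvPn[_ /memv_imgP[x' _ ->]]; rewrite -[lact M _ x']/(vtx true x').
set x := vtx true x' => x0; have x1 : vtx true x = x by rewrite /x vtx_vtx.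
exists 1%N, {ffun 'I_d -> k^o}, k^o, coord_fun; split; last exact: tensor_model_coord.
set Q := rep_module coord_fun.
(* The simple module at vertex 2. It is embedded in [Q] by [g] and mapped to the line of [x] by [f];
   injectivity of [M] extends [f] to [h] on [Q]. *)
pose S := rep_module (fun _ : 'I_d => 0 : 'Hom('rV[k]_0, k^o)).
pose fx : 'Hom(k^o, M) := linfun (fun c : k^o => (c : k) *: x).
have fxE c : fx c = (c : k) *: x by rewrite (linfunE (linear_smul x)).
pose gx : 'Hom(k^o, Q) := linfun (fun c : k^o => (0, c) : Q).
have gxE c : gx c = (0, c).
  by rewrite linfunE // => a b e; rewrite -[RHS]/(_ *: 0 + 0, _) scaler0 addr0.
have [v|v|i v|f hf fE] := @rep_hom k d 'rV[k]_0 k^o (fun=> 0) M 0 fx.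
- by rewrite zero_lfunE linear0.
- by rewrite fxE linearZ /= x1.
- by rewrite !zero_lfunE !linear0.
have [v|v|i v|g hg gE] := @rep_hom k d 'rV[k]_0 k^o (fun=> 0) Q 0 gx.
- by rewrite zero_lfunE linear0.
- by rewrite gxE rep_vtx.
- by rewrite !zero_lfunE !linear0.
have gK : lker g = 0%VS.
  apply/eqP; rewrite -subv0; apply/subvP => -[v c].
  rewrite memv_ker gE /= zero_lfunE add0r gxE xpair_eqE => /andP[_ /eqP ->].
  by rewrite [v]thinmx0 memv0.
have [h hh hgf] := injM S Q g f hg gK hf.
have h0 c : h (0, c) = (c : k) *: x.
  have /lfunP/(_ ((0, c) : S)) := hgf.
  by rewrite comp_lfunE gE fE /= !zero_lfunE !add0r gxE fxE.
have [z _ zx] := separating_form x0.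
(* A form [z] on [M] induces a homomorphism to [Q = I(2)]. Choosing [z x != 0] makes [r h] a nonzero
   scalar, so the image of [h] is a direct summand with complement [Ker r]. *)
pose r : 'Hom(M, Q) :=
  linfun (fun m => ([ffun i => z (arr i m)], z (vtx true m)) : Q).
have rE m : r m = ([ffun i => z (arr i m)], z (vtx true m)).
  rewrite linfunE // => c m1 m2; congr pair; last by rewrite !linearP.
  by apply/ffunP => i; rewrite !ffunE !linearP.
have hr : is_hom r.
  apply: hom_path => -[v|i] m.
    rewrite -[lact M _ m]/(vtx v m) -[lact Q _ _]/(vtx v _) rep_vtx !rE vtx_vtx.
    case: v => /=; rewrite ?linear0; congr pair; apply/ffunP => i;
      by rewrite !ffunE arr_vtx ?linear0.
  rewrite -[lact M _ m]/(arr i m) -[lact Q _ _]/(arr i _) rep_arr !rE vtx_arr.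
  rewrite coord_funE ffunE; congr pair; apply/ffunP => j; rewrite !ffunE.
  by rewrite /arr path_act linear0.
have rh y : r (h y) = z x *: y.
  case: y => u c; rewrite rE -hom_vtx // rep_vtx h0 linearZ.
  rewrite -[RHS]/(z x *: u, z x *: c); congr pair; last exact: mulrC.
  apply/ffunP => i; rewrite !ffunE -hom_arr // rep_arr h0 coord_funE.
  by rewrite linearZ; apply: mulrC.
have [||E|rK] := indecomposable_split (hom_limg hh) (hom_lker hr) indM.
- apply/eqP; rewrite eqEsubv subvf; apply/subvP => m _.
  rewrite -[m](subrK (h ((z x)^-1 *: r m))) addrC memv_add ?memv_img ?memvf //.
  by rewrite memv_ker linearB /= rh scalerA mulfV // scale1r subrr.
- apply/eqP; rewrite -subv0; apply/subvP => m; rewrite memv_cap => /andP[].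
  case/memv_imgP => y _ ->; rewrite memv_ker rh scaler_eq0 (negPf zx) => /eqP ->.
  by rewrite linear0 mem0v.
- have : h (0, 1 : k^o) \in limg h by rewrite memv_img ?memvf.
  by rewrite E h0 scale1r (negPf x0).
apply: embeds_onto_iso; exists r; split=> //.
apply/eqP; rewrite eqEsubv subvf; apply/subvP => y _.
apply/memv_imgP; exists (h ((z x)^-1 *: y)); rewrite ?memvf // rh.
by rewrite scalerA mulfV // scale1r.
Qed.

Lemma postinjective_model M : postinjective M ->
  exists (n : nat) (V1 V2 : vectType k) (B : 'I_d -> 'Hom(V1, V2)),
    fdmod_iso M (rep_module B) /\ tensor_model n B.
Proof.
case=> _ [r [J [indJ injJ]]]; elim: r M => [|r IH] M /= => [MJ|[N NJ tN]].
  have [n [V1 [V2 [B [iso mod]]]]] := injective_model indJ injJ.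
  by exists n, V1, V2, B; split=> //; apply: iso_trans iso.
have [n [V1 [V2 [B [iso mod]]]]] := IH N NJ.
have [K [L [p [b [pK bK Miso]]]]] :=
  AR_translate_rep (tensor_model_onto mod) iso tN.
exists n.+2, L, K, b; split=> //.
by apply: (tensor_model_kernel bK); apply: tensor_model_kernel pK mod.
Qed.

End Model.

(** * Fragmentation *)

Section Fragmentation.
Variables (k : fieldType) (d : nat) (D F : 'I_d).
Hypothesis DF : D != F.
Local Notation A := (kronecker_algebra k d).
Implicit Types M N : fdmodule A.

(** The model [T_(n+1) => T_n] transported to forms on [M] itself; note the shift of the index. *)
Definition module_coords (n : nat) M (sg : 'I_d -> 'I_d)
    (z1 z2 : seq 'I_d -> 'Hom(M, k^o)) : Prop :=
  [/\ forall a w m, z1 w (lact M a m) = a (inl false) * z1 w m,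
      forall a w m, size w = n -> z2 w (lact M a m) =
        a (inl true) * z2 w m + \sum_i a (inr (sg i)) * z1 (i :: w) m,
      forall m, tensor_rel D F n.+1 (fun w => z1 w m) /\
                tensor_rel D F n (fun w => z2 w m),
      forall m, (forall w, size w = n.+1 -> z1 w m = 0) ->
        (forall w, size w = n -> z2 w m = 0) -> m = 0 &
      forall f1 f2, tensor_rel D F n.+1 f1 -> tensor_rel D F n f2 ->
        exists m, (forall w, size w = n.+1 -> z1 w m = f1 w) /\
                  (forall w, size w = n -> z2 w m = f2 w)].

Lemma model_coords n (V1 V2 : vectType k) (B : 'I_d -> 'Hom(V1, V2)) M :
  fdmod_iso M (rep_module B) -> tensor_model D F n.+1 B ->
  exists sg z1 z2, @module_coords n M sg z1 z2.
Proof.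
move=> [f hf bf] [sg [g1 [g2 [g21 [g1T g1i g1o] [g2T g2i g2o]]]]].
have [fK fT] := iso_bij bf.
pose z1 w : 'Hom(M, k^o) := linfun (fun m : M => g1 w (f m).1).
pose z2 w : 'Hom(M, k^o) := linfun (fun m : M => g2 w (f m).2).
have z1E w m : z1 w m = g1 w (f m).1 by rewrite linfunE // => c x y; rewrite !linearP.
have z2E w m : z2 w m = g2 w (f m).2 by rewrite linfunE // => c x y; rewrite !linearP.
exists sg, z1, z2; split.
- by move=> a w m; rewrite !z1E hf rep_moduleE linearZ.
- move=> a w m hw; rewrite !z2E hf rep_moduleE linearD linearZ linear_sum /=.
  congr (_ + _); rewrite (reindex_perm sg) /=; apply: eq_bigr => i _.
  by rewrite linearZ /= g21 ?hw // z1E.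
- move=> m; split.
    by apply: tensor_rel_eq (g1T (f m).1) => w _; rewrite z1E.
  by apply: tensor_rel_eq (g2T (f m).2) => w _; rewrite z2E.
- move=> m m1 m2; suff : m \in lker f by rewrite fK memv0 => /eqP.
  rewrite memv_ker [f m]surjective_pairing (g1i (f m).1) => [|w hw].
    by rewrite (g2i (f m).2) // => w hw; rewrite -z2E m2.
  by rewrite -z1E m1.
- move=> f1 f2 /g1o[v1 v1E] /g2o[v2 v2E]; exists (f^-1%VF (v1, v2)).
  have E : f (f^-1%VF (v1, v2)) = (v1, v2) by rewrite limg_lfunVK // fT memvf.
  by split=> w hw; rewrite ?z1E ?z2E E ?v1E ?v2E.
Qed.

Lemma tensor_coords_dim n (V : vectType k) (g : seq 'I_d -> 'Hom(V, k^o)) :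
  tensor_coords D F n g -> (\dim {:V} <= d ^ n)%N.
Proof.
move=> [_ gi _]; have := dim_cap_annihilator (fun w : n.-tuple 'I_d => g w) fullv xpredT.
suff -> : (fullv :&: annihilator (fun w : n.-tuple 'I_d => g w) xpredT = 0)%VS.
  by rewrite dimv0 add0n card_tuple card_ord.
apply/eqP; rewrite -subv0; apply/subvP => v.
rewrite memv_cap memv0 => /andP[_ /annihilatorP v0].
by apply/eqP/gi => w /eqP hw; apply: (v0 (Tuple hw)).
Qed.

Lemma iso_dim M N : fdmod_iso M N -> \dim {:M} = \dim {:N}.
Proof.
case=> f _ /iso_bij[fK <-]; rewrite limg_dim_eq // fK; exact: capv0.
Qed.

Lemma model_dim n (V1 V2 : vectType k) (B : 'I_d -> 'Hom(V1, V2)) M r :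
  (n <= r)%N -> fdmod_iso M (rep_module B) -> tensor_model D F n B ->
  (\dim {:M} <= d ^ r.+1 + d ^ r)%N.
Proof.
move=> nr /iso_dim -> [sg [g1 [g2 [_ /tensor_coords_dim h1 h2]]]].
have d0 : (0 < d)%N by apply: leq_ltn_trans (ltn_ord D).
rewrite [\dim _]dimvf [dim _]/(dim V1 + dim V2)%N -!dimvf leq_add //.
  by apply: leq_trans h1 _; rewrite leq_pexp2l // ltnW.
case: n => [|n] in nr h1 h2 *.
  suff -> : {:V2}%VS = 0%VS by rewrite dimv0.
  by apply/eqP; rewrite -subv0; apply/subvP => v _; rewrite (h2 v) mem0v.
by apply: leq_trans (tensor_coords_dim h2) _; rewrite leq_pexp2l // ltnW.
Qed.

Section Blocks.
Variables (r l : nat) (M : fdmodule A) (sg : 'I_d -> 'I_d).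
Variables z1 z2 : seq 'I_d -> 'Hom(M, k^o).
Hypothesis coords : @module_coords (r + l) M sg z1 z2.

Local Notation J := ((r + l).+1.-tuple 'I_d + (r + l).-tuple 'I_d)%type.
Local Notation normal := (normal_word D F).

Let z (j : J) : 'Hom(M, k^o) :=
  match j with inl w => z1 w | inr w => z2 w end.

Let cutP (j : J) :=
  if j is inl w then normal w && (take r w == nseq r F) else false.

(** The coordinates required to vanish. The suffix starts after [r + 1] letters at vertex 1 but
    after [r] at vertex 2, since an arrow deletes the first letter. *)
Let blockP (u : l.-tuple 'I_d) (j : J) :=
  match j with
  | inl w => normal w && ((take r w == nseq r F) || (drop r.+1 w != u))
  | inr w => normal w && (drop r w != u)
  end.

Definition cut : {vspace M} := annihilator z cutP.
Definition block u : {vspace M} := annihilator z (blockP u).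

Let inj_normal m :
  (forall w, size w = (r + l).+1 -> normal w -> z1 w m = 0) ->
  (forall w, size w = (r + l)%N -> normal w -> z2 w m = 0) -> m = 0.
Proof.
case: coords => _ _ cT cinj _ h1 h2; have [T1 T2] := cT m.
by apply: cinj; [apply: (tensor_normal_eq0 T1)|apply: (tensor_normal_eq0 T2)].
Qed.

Lemma cut_submodule : is_submodule cut.
Proof.
case: coords => c1 _ _ _ _; apply/submoduleP => a m /annihilatorP hm.
apply/annihilatorP => -[w|w] //= hw.
by have := hm (inl w) hw; rewrite /= c1 => ->; rewrite mulr0.
Qed.

Lemma block_submodule u : is_submodule (block u).
Proof.
case: coords => c1 c2 cT _ _; apply/submoduleP => a m /annihilatorP hm.
have h1 w : size w = (r + l).+1 -> normal w ->
    (take r w == nseq r F) || (drop r.+1 w != u) -> z1 w m = 0.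
  move=> /eqP hw nw hP; have := hm (inl (Tuple hw)); apply.
  by rewrite /= nw.
have h2 w : size w = (r + l)%N -> normal w -> drop r w != u -> z2 w m = 0.
  move=> /eqP hw nw hP; have := hm (inr (Tuple hw)); apply.
  by rewrite /= nw.
have [T1 _] := cT m.
(* Vanishing was imposed at normal words only. It extends to all [c] because [f (F^r _)] satisfies
   the relations and the prefix [F^r] does not affect normality. *)
have cut0 c : size c = l.+1 -> z1 (nseq r F ++ c) m = 0.
  have T : tensor_rel D F l.+1 (fun c => z1 (nseq r F ++ c) m).
    by apply: (@tensor_rel_drop _ _ _ _ _ (fun w => z1 w m)); rewrite size_nseq addnS.
  apply: (tensor_normal_eq0 T) => {}c hc nc; rewrite h1 //.
  - by rewrite size_cat size_nseq hc addnS.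
  - by rewrite normal_cat_nseqF.
  - by rewrite take_size_cat ?size_nseq // eqxx.
apply/annihilatorP => -[w|w] /= /andP[nw hw].
  by rewrite c1 h1 ?mulr0 ?size_tuple.
rewrite c2 ?size_tuple // h2 ?size_tuple // mulr0 add0r big1 // => i _.
rewrite (@tensor_suffix_eq0 _ _ D F DF r l u (fun w => z1 w m)) ?mulr0 ?size_tuple //.
by move=> v hv nv uv; rewrite h1 // uv orbT.
Qed.

Lemma sum_block : (\sum_u block u)%VS = cut.
Proof.
apply/eqP; rewrite eqEsubv; apply/andP; split.
  apply/subv_sumP => u _; apply/subvP => m /annihilatorP hm.
  apply/annihilatorP => -[w|//] /= /andP[nw hw].
  by apply: (hm (inl w)); rewrite /= nw hw.
apply/subvP => m /annihilatorP hm; case: coords => _ _ _ _ onto.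
(* The component of [m] in the block of [u]: keep the normal coordinates with suffix [u] and replace
   the others by zero. *)
have ex u : exists mu, mu \in block u /\
    (forall w, size w = (r + l).+1 -> normal w ->
      z1 w mu = if drop r.+1 w == u then z1 w m else 0) /\
    (forall w, size w = (r + l)%N -> normal w ->
      z2 w mu = if drop r w == u then z2 w m else 0).
  have [f1 T1 E1] := tensor_extend DF (r + l).+1
    (fun w => if drop r.+1 w == u then z1 w m else 0 : k).
  have [f2 T2 E2] := tensor_extend DF (r + l)
    (fun w => if drop r w == u then z2 w m else 0 : k).
  have [mu [mu1 mu2]] := onto f1 f2 T1 T2.
  have {}E1 w : size w = (r + l).+1 -> normal w ->
      z1 w mu = if drop r.+1 w == u then z1 w m else 0.
    by move=> hw nw; rewrite mu1 // E1.
  have {}E2 w : size w = (r + l)%N -> normal w ->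
      z2 w mu = if drop r w == u then z2 w m else 0.
    by move=> hw nw; rewrite mu2 // E2.
  exists mu; split=> //; apply/annihilatorP => -[w|w] /= /andP[nw hw].
    rewrite E1 ?size_tuple //; case: (eqVneq (drop r.+1 w)) hw => //= _; rewrite orbF => hw.
    by apply: (hm (inl w)); rewrite /= nw hw.
  by rewrite E2 ?size_tuple // (negPf hw).
have /fin_all_exists[mu /all_and2[muB /all_and2[mu1 mu2]]] := ex.
suff -> : m = \sum_u mu u.
  by apply: memv_suml => u _; apply: (subvP (sumv_sup u _ (subvv _))).
apply/eqP; rewrite -subr_eq0; apply/eqP/inj_normal => w hw nw.
  have hu : size (drop r.+1 w) == l by rewrite size_drop hw subSS addKn.
  rewrite linearB linear_sum /= (bigD1 (Tuple hu)) //= mu1 // eqxx big1 ?addr0 ?subrr //.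
  by move=> u uw; rewrite mu1 //; case: (eqVneq (drop r.+1 w)) => // E;
    rewrite -val_eqE /= E eqxx in uw.
have hu : size (drop r w) == l by rewrite size_drop hw addKn.
rewrite linearB linear_sum /= (bigD1 (Tuple hu)) //= mu2 // eqxx big1 ?addr0 ?subrr //.
by move=> u uw; rewrite mu2 //; case: (eqVneq (drop r w)) => // E;
  rewrite -val_eqE /= E eqxx in uw.
Qed.

Lemma block_independent (m : l.-tuple 'I_d -> M) :
  (forall u, m u \in block u) -> \sum_u m u = 0 -> forall u, m u = 0.
Proof.
move=> mB m0 u; apply: inj_normal => w /eqP hw nw.
- have other (u' : l.-tuple 'I_d) : drop r.+1 w != u' -> z1 w (m u') = 0.
    move=> hu; have /annihilatorP := mB u'; move=> /(_ (inl (Tuple hw))); apply.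
    by rewrite /= nw hu orbT.
  have [E|] := eqVneq (drop r.+1 w) u; last exact: other.
  have := congr1 (z1 w) m0; rewrite linear0 linear_sum (bigD1 u) //= big1 ?addr0 //.
  by move=> u' uu'; rewrite other // E val_eqE eq_sym.
- have other (u' : l.-tuple 'I_d) : drop r w != u' -> z2 w (m u') = 0.
    move=> hu; have /annihilatorP := mB u'; move=> /(_ (inr (Tuple hw))); apply.
    by rewrite /= nw hu.
  have [E|] := eqVneq (drop r w) u; last exact: other.
  have := congr1 (z2 w) m0; rewrite linear0 linear_sum (bigD1 u) //= big1 ?addr0 //.
  by move=> u' uu'; rewrite other // E val_eqE eq_sym.
Qed.

(** An element of the block is determined by its coordinates at words ending in [u], which leave
    [r + 1] letters free at vertex 1 and [r] at vertex 2. *)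
Lemma dim_block u : (\dim (block u) <= d ^ r.+1 + d ^ r)%N.
Proof.
pose Q (j : J) := match j with
  inl w => drop r.+1 w == u :> seq _ | inr w => drop r w == u :> seq _ end.
apply: leq_trans (dim_cap_annihilator z (block u) Q) _.
have -> : (block u :&: annihilator z Q = 0)%VS.
  apply/eqP; rewrite -subv0; apply/subvP => m; rewrite memv_cap.
  case/andP => /annihilatorP mB /annihilatorP mQ; rewrite memv0.
  apply/eqP/inj_normal => w /eqP hw nw.
    have [E|E] := eqVneq (drop r.+1 w) u.
      by apply: (mQ (inl (Tuple hw))); rewrite /= E.
    by apply: (mB (inl (Tuple hw))); rewrite /= nw E orbT.
  have [E|E] := eqVneq (drop r w) u.
    by apply: (mQ (inr (Tuple hw))); rewrite /= E.
  by apply: (mB (inr (Tuple hw))); rewrite /= nw E.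
rewrite dimv0 add0n.
pose h (x : r.+1.-tuple 'I_d + r.-tuple 'I_d) : J := match x with
  inl x => inl [tuple of x ++ u] | inr x => inr [tuple of x ++ u] end.
have <- : #|{: r.+1.-tuple 'I_d + r.-tuple 'I_d}| = (d ^ r.+1 + d ^ r)%N.
  by rewrite card_sum !card_tuple card_ord.
apply: leq_trans (leq_imset_card h _); apply/subset_leq_card/subsetP => -[w|w] /eqP E.
  have sz : size (take r.+1 w) == r.+1 by rewrite size_takel // size_tuple ltnS leq_addr.
  apply/imsetP; exists (inl (Tuple sz)) => //; congr inl; apply: val_inj.
  by rewrite /= -E cat_take_drop.
have sz : size (take r w) == r by rewrite size_takel // size_tuple leq_addr.
apply/imsetP; exists (inr (Tuple sz)) => //; congr inr; apply: val_inj.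
by rewrite /= -E cat_take_drop.
Qed.

(** The codimension is at most the number of normal words beginning with [F^r], hence at most that
    of normal words of length [l + 1]. Multiplied by [2^r], this is at most the number of normal
    words of length [r + l + 1], which are independent coordinates on [M]. *)
Lemma dim_cut G : G != D -> G != F ->
  (2 ^ r * (\dim {:M} - \dim cut) <= \dim {:M})%N.
Proof.
move=> GD GF; case: coords => _ _ _ _ onto.
pose nl : J -> bool := fun j => if j is inl w then normal w else false.
have := @card_le_dim k M J z nl.
pose NS := [set w : (r + l).+1.-tuple 'I_d | normal w].
have -> : #|nl| = #|NS|.
  rewrite -(card_imset NS (@inl_inj _ ((r + l).-tuple 'I_d))).
  apply: eq_card => -[w|w]; rewrite [LHS]unfold_in /=.
    by rewrite mem_imset ?inE //; apply: inl_inj.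
  by apply/esym/negbTE/negP => /imsetP[].
move=> dimM; apply: leq_trans (dimM _); last first.
  move=> h; have [f fT fE] := tensor_extend DF (r + l).+1
    (fun w => if insub w is Some w' then h (inl w') else 0 : k).
  have T0 : tensor_rel D F (r + l) (fun=> 0 : k) by move=> a b _; apply: big1.
  have [m [mE _]] := onto f _ fT T0.
  exists m => -[w|//] /= nw; rewrite mE ?size_tuple // fE ?size_tuple //.
  by rewrite valK.
apply: leq_trans (card_normal_exp DF GD GF (esym (addnS r l))).
rewrite leq_mul2l; apply/orP; right.
apply: leq_trans (card_normal_prefix DF (esym (addnS r l))).
rewrite leq_subLR; apply: leq_trans (dim_cap_annihilator z fullv cutP) _.
rewrite capfv leq_add2l; set X := [set w | _].
rewrite -(card_imset X (@inl_inj _ ((r + l).-tuple 'I_d))).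
apply/subset_leq_card/subsetP => -[w|//] hw; rewrite mem_imset ?inE //.
exact: inl_inj.
Qed.

End Blocks.

Lemma model_fragments n (V1 V2 : vectType k) (B : 'I_d -> 'Hom(V1, V2)) M r G :
  G != D -> G != F -> fdmod_iso M (rep_module B) -> tensor_model D F n B ->
  exists (U : {vspace M}) (hU : is_submodule U),
    (2 ^ r * (\dim {:M} - \dim U) <= \dim {:M})%N /\
    exists (t : nat) (N : 'I_t -> fdmodule A),
      (forall i, \dim {:N i} <= d ^ r.+1 + d ^ r)%N /\
      fdmod_iso (submod hU) (\big[@dsum k A/zero_module A]_(i < t) N i).
Proof.
(* For [n <= r] the words are too short to be cut, but [M] itself obeys the bound and serves as the
   only fragment. *)
move=> GD GF iso mod; have [nr|rn] := leqP n r.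
  have hU : is_submodule (fullv : {vspace M}) by move=> a; apply: subvf.
  exists fullv, hU; split; first by rewrite subnn muln0.
  exists 1%N, (fun=> M); split=> [i|]; first exact: model_dim nr iso mod.
  apply: embeds_submod_iso; rewrite big_ord_recl big_ord0 -[fullv]addv0.
  apply: embeds_dsum; [|exact: embeds_zero|exact: capv0].
  exists \1%VF; split; first by move=> a m; rewrite !id_lfunE.
    by apply/eqP/lker0P => x y; rewrite !id_lfunE.
  by rewrite lim1g.
have [l nE] : exists l, n = (r + l).+1.
  by exists (n - r.+1)%N; rewrite -addSn subnKC.
rewrite nE in mod; have [sg [z1 [z2 co]]] := model_coords iso mod.
exists (cut r l z1 z2), (cut_submodule co); split; first exact: (dim_cut co GD GF).
have [t [N [Ndim Nemb]]] := embeds_finsum (block_submodule co) (block_independent co).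
exists t, N; split=> [i|].
  by have [u ->] := Ndim i; apply: (dim_block co).
by apply: embeds_submod_iso; rewrite (sum_block co) in Nemb.
Qed.

End Fragmentation.

Theorem proposition13 (R : realType) (k : fieldType) (d : nat)
    (hd : (3 <= d)%N) :
  hyperfinite R
    (fun M : fdmodule (kronecker_algebra k d) => postinjective M).
Proof.
move=> eps eps0; pose F := Ordinal (leq_trans (isT : 0 < 3)%N hd).
pose D := Ordinal (leq_trans (isT : 1 < 3)%N hd).
pose G := Ordinal (leq_trans (isT : 2 < 3)%N hd).
(* Then [eps^-1 < r < 2^r], so a codimension of at most [2^-r] times the dimension is within
   [eps]. *)
pose r := Num.bound eps^-1.
have epsr : 1 <= eps * (2 ^ r)%:R.
  rewrite mulrC -ler_pdivrMr // mul1r.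
  apply/ltW/(lt_le_trans (archi_boundP _)); first by rewrite invr_ge0 ltW.
  by rewrite ler_nat ltnW // ltn_expl.
exists (d ^ r.+1 + d ^ r)%:R.
  by rewrite ltr0n addn_gt0 expn_gt0 (leq_trans _ hd).
move=> M /(@postinjective_model k d D F isT)[n [V1 [V2 [B [iso mod]]]]].
have [U [hU [dU [t [N [Ndim Niso]]]]]] :=
  @model_fragments k d D F isT n V1 V2 B M r G isT isT iso mod.
exists U, hU; split; last first.
  by exists t, N; split=> // i; rewrite ler_nat.
have UM : (\dim U <= \dim {:M})%N by rewrite dimvS ?subvf.
rewrite mulrBl mul1r lerBlDr -lerBlDl -natrB //.
have p0 : (0 : R) < (2 ^ r)%:R by rewrite ltr0n expn_gt0.
rewrite -(ler_pM2l p0) -natrM; apply: le_trans (_ : (\dim {:M})%:R <= _).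
  by rewrite ler_nat.
by rewrite mulrA [_ * eps]mulrC ler_peMl ?ler0n.
Qed.
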